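(* Suppose that the Cauchy problem $$u''(t)+\left(\alpha+\beta\|A^{1/2}u(t)\|^2\right)Au(t)+a_1Bv(t)=f_1(t),\qquad v''(t)+\gamma Av(t)+\delta Cv(t)+a_2Bu(t)=f_2(t),\quad t\in[0,T],$$ $$u(0)=\varphi_0,\quad u'(0)=\varphi_1,\quad v(0)=\psi_0,\quad v'(0)=\psi_1$$ in the real Hilbert space $\mathcal H$ is well-posed, let $(u,v)$ be its solution, and suppose that: (a) $\varphi_0,\psi_0\in D(A)$, and $\varphi_1,\psi_1,\varphi_2,\psi_2\in D(A^{1/2})$; $f_1(t)$ and $f_2(t)$ are continuous functions; moreover $f_1(t),f_2(t)\in D(A^{1/2})$ for all $t\in[0,T]$, and $A^{1/2}f_1(t)$ and $A^{1/2}f_2(t)$ are also continuous functions. (b) $u(t)$ and $v(t)$ are continuously differentiable up to and including third order, and $u'''(t)$ and $v'''(t)$ satisfy the Lipschitz condition. (c) $Au(t)$ and $Av(t)$ are continuously differentiable; moreover $Au'(t)$ and $Av'(t)$ are Lipschitz continuous functions. Let $u_k,v_k$ be the approximations produced by the three-layer semi-discrete scheme with step $\tau=T/n$ described in the context. Then there exists $\overline T$ with $0<\overline T\le T$ such that, with $m=[\overline T/\tau]$, $$\max_{1\le k\le \min(m,n-1)}\left\|u'(t_k)-\frac{u_{k+1}-u_{k-1}}{2\tau}\right\|\le c\,\tau^2,\qquad \max_{1\le k\le \min(m,n-1)}\left\|v'(t_k)-\frac{v_{k+1}-v_{k-1}}{2\tau}\right\|\le c'\,\tau^2,$$ where $c,c'$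 are positive constants independent of $\tau$.
   Context: $\mathcal H$ is a real Hilbert space with inner product $(\cdot,\cdot)$ and norm $\|\cdot\|$. $\alpha,\beta,\gamma,\delta$ are positive constants and $a_1,a_2$ are real constants of arbitrary sign. $A$ is a self-adjoint, positive-definite (generally unbounded) operator, independent of $t$, with dense domain $D(A)$: $A=A^*\ge\nu I$, $\nu>0$. $C$ is a symmetric bounded operator on $\mathcal H$ with $(C\varphi,\varphi)\ge0$ for all $\varphi\in\mathcal H$. $B$ is a closed linear operator with $D(A)\subset D(B)$ and $\|B\varphi\|^2\le c_B^2(A\varphi,\varphi)$ for all $\varphi\in D(A)$, for some constant $c_B>0$. $f_1,f_2:[0,T]\to\mathcal H$ are given continuous functions and $\varphi_0,\varphi_1,\psi_0,\psi_1\in\mathcal H$ are given. Solution: a pair of functions $u,v:[0,T]\to\mathcal H$ that are twice continuously differentiable, with $u(t),v(t)\in D(A)$ for every $t$, $Au$ and $Av$ continuous, satisfying the two equations on $[0,T]$ and the initial conditions. Scheme: let $n>1$ be an integer, $\tau=T/n$, $t_k=k\tau$, $L=\gamma A+\delta C$, $f_{i,k}=f_i(t_k)$, $\Delta u_{k-1}=u_k-u_{k-1}$, $\Delta^2u_{k-1}=u_{k+1}-2u_k+u_{k-1}$. The starting vectors are $$u_0=\varphi_0,\quad u_1=\varphi_0+\tau\varphi_1+\tfrac{\tau^2}{2}\varphi_2,\quad \varphi_2=f_{1,0}-a_1B\psi_0-\left(\alpha+\beta\|A^{1/2}\varphi_0\|^2\right)A\varphi_0,$$ $$v_0=\psi_0,\quad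 v_1=\psi_0+\tau\psi_1+\tfrac{\tau^2}{2}\psi_2,\quad \psi_2=f_{2,0}-a_2B\varphi_0-L\psi_0,$$ and for $k=1,\dots,n-1$ the vectors $u_{k+1},v_{k+1}$ are determined (uniquely) by $$\frac{\Delta^2u_{k-1}}{\tau^2}+\left(\alpha+\beta\|A^{1/2}u_k\|^2\right)\frac{Au_{k+1}+Au_{k-1}}{2}=f_{1,k}-a_1Bv_k,$$ $$\frac{\Delta^2v_{k-1}}{\tau^2}+\frac{Lv_{k+1}+Lv_{k-1}}{2}=f_{2,k}-a_2Bu_k.$$ $[\cdot]$ denotes the integer part. *)

(* Defs.v *)
From HB Require Import structures.
From mathcomp Require Import all_boot all_order all_algebra.
From mathcomp Require Import sesquilinear.
From mathcomp Require Import all_classical all_reals all_analysis.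

Set Implicit Arguments.
Unset Strict Implicit.
Unset Printing Implicit Defensive.

Import Order.TTheory GRing.Theory Num.Theory.
Import numFieldNormedType.Exports.

Local Open Scope classical_set_scope.
Local Open Scope ring_scope.

(* A linear operator in [H] with domain [dom]; the values of [app] outside
   [dom] are meaningless and no definition below depends on them. *)
Record unbounded_op (R : realType) (H : completeNormedModType R) := UnboundedOp {
  dom : set H;
  app :> H -> H;
  dom0 : dom 0;
  dom_lin : forall (a : R) x y, dom x -> dom y -> dom (a *: x + y);
  app_lin : forall (a : R) x y, dom x -> dom y ->
    app (a *: x + y) = a *: app x + app y }.

Section Operators.
Context (R : realType) (H : completeNormedModType R).
(* the real inner product; the compatibility with the norm of [H] is a
   hypothesis of the theorem, so that [(H, ip)] is a real Hilbert space *)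
Context (ip : {dot H for @idfun R}).
Implicit Types Q S : unbounded_op H.

Definition graph Q : set (H * H) := [set p | dom Q p.1 /\ p.2 = Q p.1].

Definition closed_op Q := closed (graph Q).

(* graph of the adjoint; it is single-valued when [dom Q] is dense *)
Definition adjoint_graph Q : set (H * H) :=
  [set p | forall x, dom Q x -> ip (Q x) p.1 = ip x p.2].

Definition self_adjoint Q := dense (dom Q) /\ graph Q = adjoint_graph Q.

(* S = Q^(1/2): S is self-adjoint, nonnegative, and S o S = Q, domains
   included. For Q self-adjoint and nonnegative there is exactly one such
   operator (up to the values outside its domain). *)
Definition is_sqrt_op Q S :=
  [/\ self_adjoint S,
      (forall x, dom S x -> 0 <= ip (S x) x) &
      graph Q = [set p | exists2 z, graph S (p.1, z) & graph S (z, p.2)]].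

End Operators.

Section Calculus.
Context (R : realType) (H : completeNormedModType R) (T : R).
Implicit Types f : R -> H.

Definition diff_quot f (t s : R) : H := (s - t)^-1 *: (f s - f t).

(* The limits are taken within [0, T], hence one-sided at 0 and at T. *)
Definition derivable_on f := forall t, t \in `[0, T] ->
  cvg (diff_quot f t s @[s --> within `[0, T] t^']).

Definition derive_on f (t : R) : H :=
  lim (diff_quot f t s @[s --> within `[0, T] t^']).

Fixpoint contdiff (k : nat) f : Prop :=
  {within `[0, T], continuous f} /\
  (if k is k'.+1 then derivable_on f /\ contdiff k' (derive_on f) else True).

End Calculus.

Record system (R : realType) (H : completeNormedModType R) := System {
  alpha : R; beta : R; gamma : R; delta : R; a1 : R; a2 : R;
  opA : unbounded_op H;
  opA12 : unbounded_op H; (* A^(1/2) *)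
  opB : unbounded_op H;
  opC : {linear H -> H} }.

Record data (R : realType) (H : completeNormedModType R) := Data {
  f1 : R -> H; f2 : R -> H;
  phi0 : H; phi1 : H; psi0 : H; psi1 : H }.

Section Problem.
Context (R : realType) (H : completeNormedModType R).
Implicit Types (P : system H) (D : data H) (u v : R -> H) (T : R).

Definition kirchhoff P (x : H) : R := alpha P + beta P * `|opA12 P x| ^+ 2.

(* meaningful on D(A) only *)
Definition opL P (x : H) : H := gamma P *: opA P x + delta P *: opC P x.

Definition is_solution P T D u v :=
  [/\ contdiff T 2 u /\ contdiff T 2 v,
      (forall t, t \in `[0, T] -> dom (opA P) (u t) /\ dom (opA P) (v t)),
      {within `[0, T], continuous (fun t => opA P (u t))} /\
      {within `[0, T], continuous (fun t => opA P (v t))},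
      (forall t, t \in `[0, T] ->
        derive_on T (derive_on T u) t + kirchhoff P (u t) *: opA P (u t)
          + a1 P *: opB P (v t) = f1 D t /\
        derive_on T (derive_on T v) t + gamma P *: opA P (v t)
          + delta P *: opC P (v t) + a2 P *: opB P (u t) = f2 D t) &
      [/\ u 0 = phi0 D, derive_on T u 0 = phi1 D,
          v 0 = psi0 D & derive_on T v 0 = psi1 D] ].

(* [D'] is within [eta] of [D] in the data space
     D(A) x D(A^(1/2)) x C([0, T]; D(A^(1/2)))
   for each of the two equations. As A is positive definite, ||A x|| and
   ||A^(1/2) x|| are equivalent to the graph norms. *)
Definition close_data P T (eta : R) D D' :=
  let small_in (Q : unbounded_op H) x := dom Q x /\ `|Q x| <= eta in
  let small_source (g : R -> H) :=
    (forall t, t \in `[0, T] -> small_in (opA12 P) (g t)) /\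
    {within `[0, T], continuous (fun t => opA12 P (g t))} in
  [/\ small_in (opA P) (phi0 D' - phi0 D),
      small_in (opA P) (psi0 D' - psi0 D),
      small_in (opA12 P) (phi1 D' - phi1 D),
      small_in (opA12 P) (psi1 D' - psi1 D) &
      small_source (fun t => f1 D' t - f1 D t) /\
      small_source (fun t => f2 D' t - f2 D t)].

(* Hadamard well-posedness at the data [D]: existence, uniqueness, and
   continuity of the solution, in C([0, T]; H), with respect to the data. The
   data topology is strong and the solution topology is weak, which makes
   this a weak form of continuous dependence. *)
Definition well_posed P T D :=
  [/\ (exists u v, is_solution P T D u v),
      (forall u v u' v', is_solution P T D u v -> is_solution P T D u' v' ->
        forall t, t \in `[0, T] -> u t = u' t /\ v t = v' t) &
      (forall u v, is_solution P T D u v ->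
        forall eps : R, 0 < eps -> exists2 eta : R, 0 < eta &
        forall D' u' v', close_data P T eta D D' -> is_solution P T D' u' v' ->
        forall t, t \in `[0, T] ->
          `|u' t - u t| <= eps /\ `|v' t - v t| <= eps)].

Definition phi2 P D : H :=
  f1 D 0 - a1 P *: opB P (psi0 D) - kirchhoff P (phi0 D) *: opA P (phi0 D).

Definition psi2 P D : H :=
  f2 D 0 - a2 P *: opB P (phi0 D) - opL P (psi0 D).

(* [U k] and [V k], 0 <= k <= n, are the vectors u_k, v_k of the scheme with
   step T / n; the vectors at which the scheme evaluates an operator are
   required to belong to the domain of that operator. *)
Definition is_scheme P T D (n : nat) (U V : nat -> H) :=
  let tau := T / n%:R in
  [/\ U 0%N = phi0 D,
      U 1%N = phi0 D + tau *: phi1 D + (tau ^+ 2 / 2) *: phi2 P D,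
      V 0%N = psi0 D,
      V 1%N = psi0 D + tau *: psi1 D + (tau ^+ 2 / 2) *: psi2 P D &
      forall k, (1 <= k <= n.-1)%N ->
        [/\ [/\ dom (opA P) (U k.-1), dom (opA P) (U k.+1),
                dom (opA P) (V k.-1) & dom (opA P) (V k.+1)],
            [/\ dom (opA12 P) (U k), dom (opB P) (U k) & dom (opB P) (V k)],
            (tau ^+ 2)^-1 *: (U k.+1 - 2 *: U k + U k.-1)
              + kirchhoff P (U k) *:
                  (2^-1 *: (opA P (U k.+1) + opA P (U k.-1)))
            = f1 D (k%:R * tau) - a1 P *: opB P (V k) &
            (tau ^+ 2)^-1 *: (V k.+1 - 2 *: V k + V k.-1)
              + 2^-1 *: (opL P (V k.+1) + opL P (V k.-1))
            = f2 D (k%:R * tau) - a2 P *: opB P (U k)]].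

End Problem.

(* Main.v *)
Require Import Defs.
From HB Require Import structures.
From mathcomp Require Import all_boot all_order all_algebra.
From mathcomp Require Import sesquilinear.
From mathcomp Require Import all_classical all_reals all_analysis.
From mathcomp Require Import ring lra.

Set Implicit Arguments.
Unset Strict Implicit.
Unset Printing Implicit Defensive.

Import Order.TTheory GRing.Theory Num.Theory.
Import numFieldNormedType.Exports.

Local Open Scope classical_set_scope.
Local Open Scope ring_scope.

(** The proof is the energy method applied to the errors z_k = u(t_k) - u_k and
    w_k = v(t_k) - v_k, closed by a bootstrap.  Write S = A^(1/2), h for the
    step and q_k = alpha + beta |S u_k|^2.

    Subtracting the scheme from the differential equations (smooth_consistent,
    residual_u_le, residual_v_le) shows that the errors solve the two discrete
    wave equations
      (z_(k+1) - 2 z_k + z_(k-1)) / h^2 + q_k A (z_(k+1) + z_(k-1)) / 2 = g_k,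
      (w_(k+1) - 2 w_k + w_(k-1)) / h^2 + L (w_(k+1) + w_(k-1)) / 2 = s_k,
    where |g_k| and |s_k| are at most a constant times h^2 + |S z_k| + |S w_k|:
    the h^2 is the truncation error, while the difference of the Kirchhoff
    coefficients and the coupling B are controlled by S z_k and S w_k.
    Pairing the first equation with z_(k+1) - z_(k-1) and the second with
    w_(k+1) - w_(k-1) (wave_energy_step) gives the growth per step of
      E_k = |(z_(k+1) - z_k) / h|^2 + q_k (|S z_(k+1)|^2 + |S z_k|^2) / 2
          + |(w_(k+1) - w_k) / h|^2
          + ((L w_(k+1), w_(k+1)) + (L w_k, w_k)) / 2.

    The obstacle is that q_k depends on k through the unknown approximations,
    so the energy identity contains q_k - q_(k-1), which must be O(h).  It is
    O(h) as long as |S z_k| and |S z_(k-1)| are at most h, for u_k then follows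
    the smooth solution; and this is implied by E_(k-1) <= M h^4 when h is
    small.  Under that hypothesis E_k - E_(k-1) is at most a constant times
    h (h^4 + E_(k-1) + E_k) (step_energy), and E_0 = O(h^4) by the choice of
    the starting vectors (start_energy).  Over a time interval that is short
    compared with that constant, the bound M h^4 therefore reproduces itself
    (energy_bootstrap).  The discrete velocities of the errors are then O(h^2),
    and the central difference of a function with Lipschitz third derivative
    is accurate to O(h^2) (derivative_error).

    A short final time is also what disposes of coarse steps: when h exceeds
    it, the range of the two maxima is empty. *)

(** * Inner products *)

Section RealInnerProduct.
Context (R : realType) (H : completeNormedModType R).
Context (ip : {dot H for @idfun R}) (hip : forall x : H, ip x x = `|x| ^+ 2).
Implicit Types (x y z : H) (a : R).

Lemma ipC x y : ip x y = ip y x.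
Proof. by rewrite hermC expr0 mul1r. Qed.

Lemma ipDl x y z : ip (x + y) z = ip x z + ip y z.
Proof. exact: linearDl. Qed.

Lemma ipZl a x y : ip (a *: x) y = a * ip x y.
Proof. exact: linearZl_LR. Qed.

Lemma ipNl x y : ip (- x) y = - ip x y.
Proof. exact: linearNl. Qed.

Lemma ipBl x y z : ip (x - y) z = ip x z - ip y z.
Proof. exact: linearBl. Qed.

Lemma ipDr x y z : ip x (y + z) = ip x y + ip x z.
Proof. by rewrite ipC ipDl !(ipC x). Qed.

Lemma ipZr a x y : ip x (a *: y) = a * ip x y.
Proof. by rewrite ipC ipZl (ipC x). Qed.

Lemma ipNr x y : ip x (- y) = - ip x y.
Proof. by rewrite ipC ipNl (ipC x). Qed.

Lemma ipBr x y z : ip x (y - z) = ip x y - ip x z.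
Proof. by rewrite ipDr ipNr. Qed.

Lemma ip0l x : ip 0 x = 0.
Proof. exact: linear0l. Qed.

Lemma ip0r x : ip x 0 = 0.
Proof. by rewrite ipC ip0l. Qed.

(** Pairing with an arbitrary vector turns an identity between linear
    combinations of vectors into a field identity between reals. *)
Lemma ip_inj x y : (forall z, ip x z = ip y z) -> x = y.
Proof.
move=> h; apply/eqP; rewrite -subr_eq0 -normr_eq0 -sqrf_eq0 -hip.
by rewrite ipBl h subrr.
Qed.

Lemma ip_CauchySchwarz x y : `|ip x y| <= `|x| * `|y|.
Proof.
have [->|x0] := eqVneq x 0; first by rewrite ip0l !normr0 mul0r.
rewrite -ler_sqr ?nnegrE ?mulr_ge0// -normrX ger0_norm ?sqr_ge0// exprMn.
rewrite -!hip.
have xx : 0 < ip x x by rewrite hip exprn_gt0 ?normr_gt0.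
have := sqr_ge0 `|ip x x *: y - ip x y *: x|; rewrite -hip.
have -> : ip (ip x x *: y - ip x y *: x) (ip x x *: y - ip x y *: x) =
    ip x x * (ip x x * ip y y - ip x y ^+ 2).
  by rewrite ipBl !ipBr !ipZl !ipZr (ipC y x); ring.
by rewrite pmulr_rge0// subr_ge0.
Qed.

Lemma ip_le x y : ip x y <= `|x| * `|y|.
Proof. exact: le_trans (ler_norm _) (ip_CauchySchwarz x y). Qed.

(** Approximate w by elements x of S in the identity |w|^2 = ip w w. *)
Lemma norm_le_dense (S : set H) (w : H) (M : R) : dense S -> 0 <= M ->
  (forall x, S x -> `|ip x w| <= M * `|x|) -> `|w| <= M.
Proof.
move=> dS M0 hw; rewrite leNgt; apply/negP => Mw.
have w0 : 0 < `|w| by exact: le_lt_trans Mw.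
(* so that e (M + |w|) is half of |w| (|w| - M) *)
pose e := `|w| * (`|w| - M) / (2 * (M + `|w|)).
have Mw0 : 0 < M + `|w| by rewrite ltr_wpDl.
have e0 : 0 < e by rewrite /e divr_gt0 ?mulr_gt0 ?subr_gt0.
have [x [wx Sx]] : ball w e `&` S !=set0.
  by apply: dS; [exists w; exact: ballxx | exact: ball_open].
move: wx; rewrite -ball_normE /= => wx.
have xw : `|x| <= `|w| + e.
  have -> : x = w - (w - x) by rewrite opprB addrC subrK.
  by apply: le_trans (ler_normB _ _) _; rewrite lerD2l ltW.
have : `|w| ^+ 2 <= M * (`|w| + e) + e * `|w|.
  rewrite -hip -[X in ip X _](subrK x) ipDl addrC; apply: lerD.
    apply: le_trans (ler_norm _) _; apply: le_trans (hw _ Sx) _.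
    exact: ler_wpM2l.
  by apply: le_trans (ip_le _ _) _; apply: ler_wpM2r => //; exact: ltW.
have -> : M * (`|w| + e) + e * `|w| = M * `|w| + `|w| * (`|w| - M) / 2.
  by rewrite /e; field; rewrite gt_eqF.
have : 0 < `|w| * (`|w| - M) by rewrite mulr_gt0// subr_gt0.
lra.
Qed.

End RealInnerProduct.

(** * Derivatives and Taylor estimates on a segment *)

Section IntervalCalculus.
Context (R : realType) (T : R) (T0 : 0 < T).

(** The derivative as a first-order expansion: unlike a difference quotient,
    this form makes sense at zero increment and passes to linear images without
    division. *)
Definition deriv_on (V : normedModType R) (f f' : R -> V) :=
  forall t, t \in `[0, T] -> forall e, 0 < e -> exists2 d, 0 < d &
  forall s, s \in `[0, T] -> `|s - t| < d ->
    `|f s - f t - (s - t) *: f' t| <= e * `|s - t|.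

(** Limits of difference quotients within [0, T] are unique, also at the
    endpoints. *)
Lemma within_dnbhs_proper (t : R) : t \in `[0, T] ->
  ProperFilter (within `[0, T] t^').
Proof.
rewrite in_itv/= => /andP[t0 tT].
apply: Build_ProperFilter_ex => P.
rewrite /within/= => /nbhs_ballP[d /= d0 hd].
have [h [h0 hd' hs]] : exists h, [/\ h != 0, `|h| < d & 0 <= t + h <= T].
  have [tT'|Tt] := ltP t T.
    exists (Num.min (d / 2) (T - t)).
    have h0 : 0 < Num.min (d / 2) (T - t) by rewrite lt_min subr_gt0 tT' divr_gt0.
    have hd2 : Num.min (d / 2) (T - t) <= d / 2 by rewrite ge_min lexx.
    have hT : Num.min (d / 2) (T - t) <= T - t by rewrite ge_min lexx orbT.
    split; [by rewrite gt_eqF | by rewrite gtr0_norm//; lra |].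
    by apply/andP; split; lra.
  exists (- Num.min (d / 2) T).
  have h0 : 0 < Num.min (d / 2) T by rewrite lt_min T0 divr_gt0.
  have hd2 : Num.min (d / 2) T <= d / 2 by rewrite ge_min lexx.
  have hT : Num.min (d / 2) T <= T by rewrite ge_min lexx orbT.
  split; [by rewrite oppr_eq0 gt_eqF | by rewrite normrN gtr0_norm//; lra |].
  by apply/andP; split; lra.
exists (t + h); apply: hd; rewrite ?in_itv//= -?ball_normE/=.
  by rewrite opprD addrA subrr sub0r normrN.
by rewrite -subr_eq0 [t + h]addrC addrK.
Qed.

Lemma derivable_onP (H : completeNormedModType R) (f : R -> H) :
  derivable_on T f -> deriv_on f (derive_on T f).
Proof.
move=> df t tT e e0; have := df t tT.
have PF := within_dnbhs_proper tT.
move=> /cvgrPdist_le /(_ _ e0); rewrite -/(derive_on T f t).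
rewrite near_withinE near_withinE => /nbhs_ballP[d d0 hd].
exists d => // s sT sd; have [->|st] := eqVneq s t.
  by rewrite !subrr scale0r subr0 !normr0 mulr0.
have := hd s; rewrite -ball_normE /= distrC => /(_ sd st sT).
rewrite /diff_quot => {}hd.
have st0 : s - t != 0 by rewrite subr_eq0.
have -> : f s - f t - (s - t) *: derive_on T f t =
   (s - t) *: ((s - t)^-1 *: (f s - f t) - derive_on T f t).
  by rewrite scalerBr scalerA mulfV// scale1r.
by rewrite normrZ mulrC distrC ler_wpM2r.
Qed.

Lemma deriv_on_sub (f f' g g' : R -> R) :
  deriv_on f f' -> deriv_on g g' ->
  deriv_on (fun s => f s - g s) (fun s => f' s - g' s).
Proof.
move=> hf hg t tT e e0.
have e20 : 0 < e / 2 by rewrite divr_gt0.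
have [d d0 hd] := hf t tT _ e20; have [c c0 hc] := hg t tT _ e20.
exists (Num.min d c) => [|s sT]; first by rewrite lt_min d0.
rewrite lt_min => /andP[sd sc].
have -> : f s - g s - (f t - g t) - (s - t) *: (f' t - g' t) =
  (f s - f t - (s - t) *: f' t) - (g s - g t - (s - t) *: g' t).
  by rewrite /GRing.scale/=; ring.
apply: le_trans (ler_normB _ _) _.
by rewrite [e]splitr mulrDl lerD// ?hd ?hc.
Qed.

(** The mean value theorem bounds a function by its derivative, with one more
    power of the distance to a zero. *)
Lemma deriv_on_growth (g g' : R -> R) (t C : R) (j : nat) :
  deriv_on g g' -> t \in `[0, T] -> g t = 0 -> 0 <= C ->
  (forall s, s \in `[0, T] -> `|g' s| <= C * `|s - t| ^+ j) ->
  forall s, s \in `[0, T] -> `|g s| <= C * `|s - t| ^+ j.+1.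
Proof.
move=> dg tT gt0 C0 hg'.
have gcont : {within `[0, T], continuous g}.
  apply/subspace_continuousP => x xT; apply/cvgrPdist_le => e e0.
  have [d d0 hd] := dg x xT 1 ltr01.
  (* the increment is at most (1 + |g' x|) times the distance *)
  have k0 : 0 < 1 + `|g' x| by rewrite ltr_wpDr.
  rewrite near_withinE; apply/nbhs_ballP.
  exists (Num.min d (e / (1 + `|g' x|))) => [|s] /=.
    by rewrite lt_min d0 divr_gt0.
  rewrite -ball_normE/= lt_min distrC ltr_pdivlMr// => /andP[sd se] sT.
  rewrite distrC -(subrK ((s - x) *: g' x) (g s - g x)).
  apply: le_trans (ler_normD _ _) _.
  apply: le_trans (lerD (hd s sT sd) (lexx _)) _.
  by rewrite mul1r normrM; lra.
have gder x : x \in `]0, T[ -> is_derive x 1 g (g' x).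
  rewrite in_itv/= => /andP[x0 xT].
  have cv : h^-1 *: ((g \o shift x) (h *: 1) - g x) @[h --> 0^'] --> g' x.
    apply/cvgrPdist_le => e e0.
    have [|d d0 hd] := dg x _ e e0; first by rewrite in_itv/= !ltW.
    apply/nbhs_ballP.
    exists (Num.min d (Num.min x (T - x))) => [|h] /=.
      by rewrite !lt_min d0 x0 subr_gt0.
    rewrite -ball_normE/= sub0r normrN !lt_min => /and3P[hd' hx hTx] h0.
    have := hd (h + x); rewrite addrK in_itv/=.
    have -> : 0 <= h + x <= T.
      by move: hx hTx; rewrite !ltr_norml => /andP[? ?] /andP[? ?];
         apply/andP; split; lra.
    move=> /(_ isT hd'); rewrite -ler_pdivrMr ?normr_gt0// -normfV -normrM.
    rewrite distrC; congr (`|_| <= _).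
    rewrite /GRing.scale/= mulr1.
    by field.
  apply: DeriveDef; first by apply/cvg_ex; exists (g' x).
  exact: cvg_lim cv.
have key a b : a \in `[0, T] -> b \in `[0, T] -> a < b ->
    exists2 c, c \in `]a, b[ & g b - g a = g' c * (b - a).
  move=> aT bT ab.
  have hder x : x \in `]a, b[ -> is_derive x 1 g (g' x).
    move=> xab; apply: gder; move: aT bT xab; rewrite !in_itv/=.
    by case/andP=> ? ? /andP[? ?] /andP[? ?]; apply/andP; split; lra.
  have hcont : {within `[a, b], continuous g}.
    apply: continuous_subspaceW gcont => x /=; move: aT bT.
    rewrite !in_itv/=.
    by case/andP=> ? ? /andP[? ?] /andP[? ?]; apply/andP; split; lra.
  exact: MVT ab hder hcont.
move=> s sT; have [st|ts|->] := ltgtP s t.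
- have [c cst] := key _ _ sT tT st; rewrite gt0 sub0r => hc.
  rewrite -normrN hc normrM distrC exprSr mulrA ler_wpM2r//.
  apply: (le_trans (hg' _ _)).
    by move: sT tT cst; rewrite !in_itv/=; lra.
  apply: ler_wpM2l => //; apply: lerXn2r; rewrite ?nnegrE//.
  by move: cst; rewrite in_itv/= => cst; rewrite !ltr0_norm; lra.
- have [c cst] := key _ _ tT sT ts; rewrite gt0 subr0 => hc.
  rewrite hc normrM exprSr mulrA ler_wpM2r//.
  apply: (le_trans (hg' _ _)).
    by move: sT tT cst; rewrite !in_itv/=; lra.
  apply: ler_wpM2l => //; apply: lerXn2r; rewrite ?nnegrE//.
  by move: cst; rewrite in_itv/= => cst; rewrite !gtr0_norm; lra.
- by rewrite gt0 normr0 mulr_ge0.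
Qed.

End IntervalCalculus.

Section Taylor.
Context (R : realType) (H : completeNormedModType R).
Context (ip : {dot H for @idfun R}) (hip : forall x : H, ip x x = `|x| ^+ 2).
Context (T : R) (T0 : 0 < T).

Lemma lipschitz_onP (f : R -> H) : [lipschitz f t | t in `[0, T]] ->
  exists2 L : R, 0 < L & forall s t, s \in `[0, T] -> t \in `[0, T] ->
    `|f s - f t| <= L * `|s - t|.
Proof.
move=> /pinfty_ex_gt0[L L0 hL]; exists L => // s t sT tT.
exact: (hL (s, t)).
Qed.

Lemma deriv_on_ip (f f' : R -> H) (x : H) : deriv_on T f f' ->
  deriv_on T (fun s => ip x (f s) : R) (fun s => ip x (f' s)).
Proof.
move=> df t tT e e0.
have x1 : 0 < 1 + `|x| by rewrite ltr_wpDr.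
have [|d d0 hd] := df t tT (e / (1 + `|x|)); first by rewrite divr_gt0.
exists d => // s sT sd.
have -> : ip x (f s) - ip x (f t) - (s - t) *: (ip x (f' t) : R) =
    ip x (f s - f t - (s - t) *: f' t) by rewrite !(ipBr, ipZr).
apply: (le_trans (ip_CauchySchwarz hip _ _)).
apply: (le_trans (ler_wpM2l (normr_ge0 _) (hd s sT sd))).
rewrite mulrA ler_wpM2r// mulrCA ler_piMr ?(ltW e0)// ler_pdivrMr//.
by rewrite mul1r; lra.
Qed.

Lemma deriv_on_cubic (t a b c d : R) : t \in `[0, T] ->
  deriv_on T
    (fun s => a + (b * (s - t) + c / 2 * (s - t) ^+ 2 + d / 6 * (s - t) ^+ 3))
    (fun s => b + c * (s - t) + d / 2 * (s - t) ^+ 2).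
Proof.
move=> tT x xT e e0; pose K := 1 + `|c| + `|d| * T.
have dT : 0 <= `|d| * T by rewrite mulr_ge0// ltW.
have K0 : 0 < K by rewrite /K; have := normr_ge0 c; lra.
exists (e / K) => [|s sT]; first by rewrite divr_gt0.
rewrite ltr_pdivlMr// => sx.
set y := (X in `|X| <= _).
have -> : y = (s - x) * ((s - x) * (c / 2 + d / 2 * (x - t) + d / 6 * (s - x))).
  by rewrite /y /GRing.scale/=; field.
rewrite normrM mulrC ler_wpM2r// normrM.
apply: (le_trans _ (ltW sx)); apply: ler_wpM2l => //.
move: tT xT sT; rewrite !in_itv/= => /andP[? ?] /andP[? ?] /andP[? ?].
have xt : `|d / 2 * (x - t)| <= `|d| / 2 * T.
  by rewrite !normrM normfV (gtr0_norm (ltr0n _ 2))// ler_wpM2l// ler_norml;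
     apply/andP; split; lra.
have sx' : `|d / 6 * (s - x)| <= `|d| / 6 * T.
  by rewrite !normrM normfV (gtr0_norm (ltr0n _ 6))// ler_wpM2l// ler_norml;
     apply/andP; split; lra.
have cc : `|c / 2| = `|c| / 2.
  by rewrite !normrM normfV (gtr0_norm (ltr0n _ 2)).
apply: (le_trans (ler_normD _ _)); apply: (le_trans (lerD (ler_normD _ _) sx')).
rewrite /K; have := normr_ge0 c.
lra.
Qed.

(** Polynomials of degree three cover every use; lower degrees are obtained by
    zero coefficients. *)
Lemma taylor_scalar (g g' : R -> R) (t b c d C : R) (j : nat) :
  deriv_on T g g' -> t \in `[0, T] -> 0 <= C ->
  (forall s, s \in `[0, T] ->
    `|g' s - (b + c * (s - t) + d / 2 * (s - t) ^+ 2)| <= C * `|s - t| ^+ j) ->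
  forall s, s \in `[0, T] ->
    `|g s - g t - (b * (s - t) + c / 2 * (s - t) ^+ 2 + d / 6 * (s - t) ^+ 3)|
      <= C * `|s - t| ^+ j.+1.
Proof.
move=> dg tT C0 hg' s sT; rewrite -addrA -opprD.
have dp := deriv_on_cubic (g t) b c d tT.
have := deriv_on_growth (deriv_on_sub dg dp) tT _ C0 hg' sT; apply.
by rewrite subrr expr2 exprS !mulr0 mul0r !mulr0 !addr0 subrr.
Qed.

(** The scalar estimate, paired with the remainder itself. *)
Lemma taylor_vector (f f' : R -> H) (t : R) (b c d : H) (C : R) (j : nat) :
  deriv_on T f f' -> t \in `[0, T] -> 0 <= C ->
  (forall s, s \in `[0, T] ->
    `|f' s - (b + (s - t) *: c + ((s - t) ^+ 2 / 2) *: d)|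
      <= C * `|s - t| ^+ j) ->
  forall s, s \in `[0, T] ->
    `|f s - f t - ((s - t) *: b + ((s - t) ^+ 2 / 2) *: c
        + ((s - t) ^+ 3 / 6) *: d)| <= C * `|s - t| ^+ j.+1.
Proof.
move=> df tT C0 hf' s sT; set w := (X in `|X| <= _).
have [->|w0] := eqVneq w 0; first by rewrite normr0 mulr_ge0.
have w1 : 0 < `|w| by rewrite normr_gt0.
rewrite -(ler_pM2l w1) -expr2 -hip mulrA [`|w| * C]mulrC.
have -> : ip w w = ip w (f s) - ip w (f t) - (ip w b * (s - t)
    + ip w c / 2 * (s - t) ^+ 2 + ip w d / 6 * (s - t) ^+ 3).
  by rewrite {2}/w !(ipBr, ipDr, ipZr); field.
apply: le_trans (ler_norm _) _.
apply: (taylor_scalar (deriv_on_ip w df)) => //; first by rewrite mulr_ge0.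
move=> x xT.
have -> : ip w (f' x) - (ip w b + ip w c * (x - t) + ip w d / 2 * (x - t) ^+ 2)
    = ip w (f' x - (b + (x - t) *: c + ((x - t) ^+ 2 / 2) *: d)).
  by rewrite !(ipBr, ipDr, ipZr); field.
apply: (le_trans (ip_CauchySchwarz hip _ _)).
by rewrite [C * _]mulrC -(mulrA `|w|) ler_wpM2l// hf'.
Qed.

Section ThirdOrder.
Context (f f1 f2 f3 : R -> H) (L : R) (L0 : 0 < L).
Context (df : deriv_on T f f1) (df1 : deriv_on T f1 f2) (df2 : deriv_on T f2 f3).
Context (hL : forall s t, s \in `[0, T] -> t \in `[0, T] ->
    `|f3 s - f3 t| <= L * `|s - t|).

Lemma taylor3 s t : s \in `[0, T] -> t \in `[0, T] ->
  `|f s - f t - ((s - t) *: f1 t + ((s - t) ^+ 2 / 2) *: f2 t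
      + ((s - t) ^+ 3 / 6) *: f3 t)| <= L * `|s - t| ^+ 4.
Proof.
move=> sT tT; have L0' := ltW L0.
have h2 x : x \in `[0, T] -> `|f2 x - f2 t - (x - t) *: f3 t| <= L * `|x - t| ^+ 2.
  move=> xT; have := taylor_vector (b := f3 t) (c := 0) (d := 0) (j := 1)
    df2 tT L0' _ xT.
  rewrite !scaler0 !addr0; apply=> y yT.
  by rewrite !scaler0 !addr0 expr1 hL.
have h1 x : x \in `[0, T] -> `|f1 x - f1 t - ((x - t) *: f2 t
    + ((x - t) ^+ 2 / 2) *: f3 t)| <= L * `|x - t| ^+ 3.
  move=> xT; have := taylor_vector (b := f2 t) (c := f3 t) (d := 0) (j := 2)
    df1 tT L0' _ xT.
  rewrite !scaler0 !addr0; apply=> y yT.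
  by rewrite !scaler0 !addr0 opprD addrA h2.
apply: (taylor_vector df tT L0') => // x xT.
by rewrite -addrA opprD addrA h1.
Qed.

End ThirdOrder.

End Taylor.

(** * Unbounded operators and their square roots *)

Section UnboundedOperators.
Context (R : realType) (H : completeNormedModType R).
Implicit Types (Q : unbounded_op H) (x y : H).

Lemma domD Q x y : dom Q x -> dom Q y -> dom Q (x + y).
Proof. by move=> dx dy; rewrite -[x]scale1r; exact: dom_lin. Qed.

Lemma appD Q x y : dom Q x -> dom Q y -> Q (x + y) = Q x + Q y.
Proof. by move=> dx dy; rewrite -[x in LHS]scale1r app_lin// scale1r. Qed.

Lemma app0 Q : Q 0 = 0.
Proof.
apply: (addrI (Q 0)); rewrite -appD ?addr0//; exact: dom0.
Qed.

Lemma domZ Q (a : R) x : dom Q x -> dom Q (a *: x).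
Proof. by move=> dx; rewrite -[_ *: _]addr0; apply: dom_lin => //; exact: dom0. Qed.

Lemma appZ Q (a : R) x : dom Q x -> Q (a *: x) = a *: Q x.
Proof.
by move=> dx; rewrite -[a *: x]addr0 app_lin ?app0 ?addr0//; exact: dom0.
Qed.

Lemma domB Q x y : dom Q x -> dom Q y -> dom Q (x - y).
Proof. by move=> dx dy; apply: domD => //; rewrite -scaleN1r; exact: domZ. Qed.

Lemma appB Q x y : dom Q x -> dom Q y -> Q (x - y) = Q x - Q y.
Proof.
move=> dx dy; rewrite -scaleN1r appD//; last exact: domZ.
by rewrite appZ// scaleN1r.
Qed.

Lemma self_adjoint_sym (ip : {dot H for @idfun R}) Q x y : self_adjoint ip Q ->
  dom Q x -> dom Q y -> ip (Q x) y = ip x (Q y).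
Proof.
move=> [_ hQ] dx dy; have : graph Q (y, Q y) by [].
by rewrite hQ => /(_ x dx).
Qed.

End UnboundedOperators.

Section PositiveOperator.
Context (R : realType) (H : completeNormedModType R).
Context (ip : {dot H for @idfun R}) (hip : forall x : H, ip x x = `|x| ^+ 2).
Context (A S : unbounded_op H).
Context (hA : self_adjoint ip A) (hS : is_sqrt_op ip A S).
Context (nu : R) (hnu : 0 < nu).
Context (hAnu : forall x, dom A x -> nu * `|x| ^+ 2 <= ip (A x) x).

Lemma sqrt_dom x : dom A x -> dom S x.
Proof.
case: hS => _ _ hg dx; have : graph A (x, A x) by [].
by rewrite hg => -[z [/= dSx _] _].
Qed.

Lemma sqrt_energy x : dom A x -> ip (A x) x = `|S x| ^+ 2.
Proof.
case: hS => sS _ hg dx; have : graph A (x, A x) by [].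
rewrite hg => -[z [/= dSx ->] [/= dSSx ->]].
by rewrite (self_adjoint_sym sS)// hip.
Qed.

(** One constant for the two embeddings |x| <= kappa |S x| <= kappa^2 |A x|; the
    optimal one is nu^(-1/2), and 1 + nu^-1 bounds it without a root. *)
Definition kappa := 1 + nu^-1.

Lemma kappa_ge1 : 1 <= kappa.
Proof. by rewrite lerDl invr_ge0 ltW. Qed.

Lemma norm_le_sqrt x : dom A x -> `|x| <= kappa * `|S x|.
Proof.
move=> dx; have k1 := kappa_ge1; have k0 : 0 <= kappa by lra.
rewrite -ler_sqr ?nnegrE ?mulr_ge0// exprMn.
have : nu * `|x| ^+ 2 <= `|S x| ^+ 2 by rewrite -sqrt_energy// hAnu.
rewrite mulrC -ler_pdivlMr// => h; apply: (le_trans h).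
rewrite mulrC ler_wpM2r ?sqr_ge0//.
have : kappa <= kappa ^+ 2 by rewrite expr2 ler_peMl.
by rewrite /kappa; lra.
Qed.

Lemma sqrt_le_app x : dom A x -> `|S x| <= kappa * `|A x|.
Proof.
move=> dx; have [->|Sx0] := eqVneq (S x) 0.
  by rewrite normr0 mulr_ge0//; have := kappa_ge1; lra.
rewrite -(@ler_pM2r _ `|S x|) ?normr_gt0// -expr2 -sqrt_energy//.
apply: (le_trans (ip_le hip _ _)).
by rewrite mulrAC mulrC ler_wpM2r// norm_le_sqrt.
Qed.

Section Evolution.
Context (T : R) (T0 : 0 < T) (u u1 : R -> H) (L : R) (L0 : 0 < L).
Context (du : deriv_on T u u1).
Context (domu : forall t, t \in `[0, T] -> dom A (u t)).
Context (domu1 : forall t, t \in `[0, T] -> dom A (u1 t)).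
Context (hL : forall s t, s \in `[0, T] -> t \in `[0, T] ->
    `|A (u1 s) - A (u1 t)| <= L * `|s - t|).

(** Pairing with a vector of the dense domain moves A onto that vector, so
    that only the derivative of u, and not that of A u, enters. *)
Lemma taylor_op s t : s \in `[0, T] -> t \in `[0, T] ->
  `|A (u s) - A (u t) - (s - t) *: A (u1 t)| <= L * `|s - t| ^+ 2.
Proof.
move=> sT tT; have LL := ltW L0.
apply: (norm_le_dense hip (proj1 hA)) => [|x dx]; first by rewrite mulr_ge0.
have shift y : dom A y -> ip x (A y) = ip (A x) y.
  by move=> dy; rewrite (self_adjoint_sym hA).
have dg := deriv_on_ip hip (A x) du.
have C0 : 0 <= L * `|x| by rewrite mulr_ge0.
have := taylor_scalar T0 (b := ip (A x) (u1 t)) (c := 0) (d := 0) (j := 1)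
  dg tT C0 _ sT.
rewrite !mul0r !addr0 !(ipBr, ipZr).
rewrite (shift _ (domu sT)) (shift _ (domu tT)) (shift _ (domu1 tT)).
rewrite [ip (A x) (u1 t) * _]mulrC mulrAC; apply=> y yT /=.
rewrite !mul0r !addr0 -(shift _ (domu1 yT)) -(shift _ (domu1 tT)) -(ipBr ip).
apply: (le_trans (ip_CauchySchwarz hip _ _)).
by rewrite expr1 mulrAC mulrC ler_wpM2r// hL.
Qed.

End Evolution.
End PositiveOperator.

(** * Truncation errors *)

Section Consistency.
Context (R : realType) (H : completeNormedModType R).
Context (ip : {dot H for @idfun R}) (hip : forall x : H, ip x x = `|x| ^+ 2).
Context (A S : unbounded_op H).
Context (hA : self_adjoint ip A) (hS : is_sqrt_op ip A S).
Context (nu : R) (hnu : 0 < nu).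
Context (hAnu : forall x, dom A x -> nu * `|x| ^+ 2 <= ip (A x) x).
Context (T : R) (T0 : 0 < T).

(** What the convergence proof needs of an exact solution component u, with
    derivatives u1 and u2: bounds and a Lipschitz estimate for the Kirchhoff
    coefficient, truncation errors of the difference quotients, and the error
    of the starting vector in the two norms that enter the energy.  The last
    estimate omits the second-order term: u2 0 need not belong to the domain of
    A, so S applied to that term is estimated separately. *)
Record consistent (u u1 u2 : R -> H) (K : R) : Prop := Consistent {
  consistent_app : forall t : R, t \in `[0, T] -> `|A (u t)| <= K;
  consistent_sqrt : forall t : R, t \in `[0, T] -> `|S (u t)| <= K;
  consistent_sqrt_lip : forall s t : R, s \in `[0, T] -> t \in `[0, T] ->
    `|S (u s - u t)| <= K * `|s - t|;
  consistent_centered : forall t h : R, 0 < h -> 0 <= t - h -> t + h <= T ->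
    `|u1 t - (2 * h)^-1 *: (u (t + h) - u (t - h))| <= K * h ^+ 2;
  consistent_second : forall t h : R, 0 < h -> 0 <= t - h -> t + h <= T ->
    `|(h ^+ 2)^-1 *: (u (t + h) - 2 *: u t + u (t - h)) - u2 t| <= K * h ^+ 2;
  consistent_mean : forall t h : R, 0 < h -> 0 <= t - h -> t + h <= T ->
    `|2^-1 *: (A (u (t + h)) + A (u (t - h))) - A (u t)| <= K * h ^+ 2;
  consistent_start : forall h : R, 0 < h -> h <= T ->
    `|u h - (u 0 + h *: u1 0 + (h ^+ 2 / 2) *: u2 0)| <= K * h ^+ 3;
  consistent_sqrt_start : forall h : R, 0 < h -> h <= T ->
    `|S (u h - u 0 - h *: u1 0)| <= K * h ^+ 2 }.

(** Third-order Taylor expansion of u and first-order expansion of A u; in the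
    symmetric combinations the lowest-order terms cancel. *)
Lemma smooth_consistent (u u1 u2 u3 : R -> H) (L LA : R) :
  0 < L -> 0 < LA ->
  deriv_on T u u1 -> deriv_on T u1 u2 -> deriv_on T u2 u3 ->
  (forall t, t \in `[0, T] -> dom A (u t)) ->
  (forall t, t \in `[0, T] -> dom A (u1 t)) ->
  (forall s t, s \in `[0, T] -> t \in `[0, T] ->
    `|u3 s - u3 t| <= L * `|s - t|) ->
  (forall s t, s \in `[0, T] -> t \in `[0, T] ->
    `|A (u1 s) - A (u1 t)| <= LA * `|s - t|) ->
  exists2 K, 0 < K & consistent u u1 u2 K.
Proof.
move=> L0 LA0 du du1 du2 domu domu1 hL hLA.
have zT : 0 \in `[0, T] by rewrite in_itv/= lexx ltW.
pose k := kappa nu; have k1 : 1 <= k := kappa_ge1 hnu.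
have tay := taylor3 hip T0 L0 du du1 du2 hL.
have tayA := taylor_op hip hA T0 LA0 du domu domu1 hLA.
have distT (s t : R) : s \in `[0, T] -> t \in `[0, T] -> `|s - t| <= T.
  rewrite !in_itv/= ler_norml => /andP[? ?] /andP[? ?].
  by apply/andP; split; lra.
have sqrt_le x : dom A x -> `|S x| <= k * `|A x|.
  exact: (sqrt_le_app hip hS hnu hAnu).
pose M3 := `|u3 0| + L * T; pose M1 := `|A (u1 0)| + LA * T.
pose MA := `|A (u 0)| + (M1 + LA * T) * T.
have LT0 : 0 < L * T by rewrite mulr_gt0.
have LAT0 : 0 < LA * T by rewrite mulr_gt0.
have M30 : 0 <= M3 by apply: addr_ge0 => //; exact: ltW.
have M10 : 0 <= M1 by apply: addr_ge0 => //; exact: ltW.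
have h3 (t : R) : t \in `[0, T] -> `|u3 t| <= M3.
  move=> tT; rewrite -(subrK (u3 0) (u3 t)) addrC.
  apply: (le_trans (ler_normD _ _)); rewrite lerD2l.
  by apply: (le_trans (hL _ _ tT zT)); rewrite ler_pM2l// distT.
have h1 (t : R) : t \in `[0, T] -> `|A (u1 t)| <= M1.
  move=> tT; rewrite -(subrK (A (u1 0)) (A (u1 t))) addrC.
  apply: (le_trans (ler_normD _ _)); rewrite lerD2l.
  by apply: (le_trans (hLA _ _ tT zT)); rewrite ler_pM2l// distT.
have lipA (s t : R) : s \in `[0, T] -> t \in `[0, T] ->
    `|A (u s) - A (u t)| <= (M1 + LA * T) * `|s - t|.
  move=> sT tT; rewrite -(subrK ((s - t) *: A (u1 t)) (_ - _)) addrC mulrDl.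
  apply: (le_trans (ler_normD _ _)); apply: lerD.
    by rewrite normrZ mulrC ler_wpM2r// h1.
  apply: (le_trans (tayA _ _ sT tT)); rewrite expr2 mulrA ler_wpM2r//.
  by rewrite ler_pM2l// distT.
have hMA (t : R) : t \in `[0, T] -> `|A (u t)| <= MA.
  move=> tT; rewrite -(subrK (A (u 0)) (A (u t))) addrC.
  apply: (le_trans (ler_normD _ _)); rewrite lerD2l.
  apply: (le_trans (lipA _ _ tT zT)); rewrite ler_wpM2l ?distT//.
  by apply: addr_ge0 => //; exact: ltW.
have MA0 : 0 <= MA.
  apply: addr_ge0 => //; apply: mulr_ge0; last exact: ltW.
  by apply: addr_ge0 => //; exact: ltW.
have kMA0 : 0 <= k * MA by rewrite mulr_ge0//; lra.
have kLA0 : 0 <= k * LA by rewrite mulr_ge0//; lra.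
have kM0 : 0 <= k * (M1 + LA * T) by rewrite mulr_ge0//; lra.
(* a sum of the bounds, so that each of them is at most K *)
pose K := 2 * L + L * T + M3 + LA + k * LA + MA + k * MA + k * (M1 + LA * T).
exists K; first by rewrite /K; lra.
have inT (t h : R) : 0 < h -> 0 <= t - h -> t + h <= T ->
    [/\ t \in `[0, T], t + h \in `[0, T], t - h \in `[0, T] & h <= T].
  by move=> h0 ? ?; split; rewrite ?in_itv/=; try (apply/andP; split); lra.
split.
- by move=> t tT; apply: (le_trans (hMA _ tT)); rewrite /K; lra.
- move=> t tT; apply: (le_trans (sqrt_le _ (domu _ tT))).
  apply: (@le_trans _ _ (k * MA)); last by rewrite /K; lra.
  by rewrite ler_wpM2l ?hMA//; lra.
- move=> s t sT tT; apply: (le_trans (sqrt_le _ (domB (domu _ sT) (domu _ tT)))).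
  rewrite appB; [|exact: domu..].
  apply: (@le_trans _ _ (k * ((M1 + LA * T) * `|s - t|))).
    by rewrite ler_wpM2l ?lipA//; lra.
  by rewrite mulrA ler_wpM2r// /K; lra.
- move=> t h h0 lo hi; have [tT tpT tmT hT] := inT _ _ h0 lo hi.
  have := tay _ _ tpT tT; have := tay _ _ tmT tT.
  rewrite [t + h - t]addrAC subrr add0r [t - h - t]addrAC subrr add0r.
  rewrite normrN (gtr0_norm h0).
  set rm := (X in `|X| <= _); set rp := (X in _ -> `|X| <= _ -> _) => hm hp.
  have -> : u1 t - (2 * h)^-1 *: (u (t + h) - u (t - h)) =
      - ((2 * h)^-1 *: (rp - rm + (h ^+ 3 / 3) *: u3 t)).
    apply: (ip_inj hip) => z; rewrite /rp /rm.
    by rewrite !(ipDl, ipBl, ipNl, ipZl); field; rewrite gt_eqF.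
  rewrite normrN normrZ gtr0_norm ?invr_gt0 ?mulr_gt0//.
  rewrite mulrC ler_pdivrMr ?mulr_gt0//.
  apply: (le_trans (ler_normD _ _)).
  apply: (le_trans (lerD (ler_normB _ _) (lexx _))).
  rewrite normrZ gtr0_norm ?divr_gt0 ?exprn_gt0//.
  have h30 : 0 < h ^+ 3 by rewrite exprn_gt0.
  have e1 : L * h ^+ 4 <= L * T * h ^+ 3.
    by rewrite exprS mulrA ler_pM2r// ler_pM2l.
  have e2 : h ^+ 3 / 3 * `|u3 t| <= M3 * h ^+ 3.
    have := h3 _ tT; have := ler_wpM2r (ltW h30) (h3 _ tT).
    have : 0 <= `|u3 t| * h ^+ 3 by rewrite mulr_ge0// ltW.
    lra.
  have -> : K * h ^+ 2 * (2 * h) = 2 * (K * h ^+ 3) by ring.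
  have e3 : L * T * h ^+ 3 + M3 * h ^+ 3 <= K * h ^+ 3.
    by rewrite -mulrDl ler_pM2r// /K; lra.
  have : 0 <= M3 * h ^+ 3 by rewrite mulr_ge0// ltW.
  lra.
- move=> t h h0 lo hi; have [tT tpT tmT hT] := inT _ _ h0 lo hi.
  have := tay _ _ tpT tT; have := tay _ _ tmT tT.
  rewrite [t + h - t]addrAC subrr add0r [t - h - t]addrAC subrr add0r.
  rewrite normrN (gtr0_norm h0).
  set rm := (X in `|X| <= _); set rp := (X in _ -> `|X| <= _ -> _) => hm hp.
  have -> : (h ^+ 2)^-1 *: (u (t + h) - 2 *: u t + u (t - h)) - u2 t =
      (h ^+ 2)^-1 *: (rp + rm).
    apply: (ip_inj hip) => z; rewrite /rp /rm.
    by rewrite !(ipDl, ipBl, ipNl, ipZl); field; rewrite gt_eqF.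
  rewrite normrZ gtr0_norm ?invr_gt0 ?exprn_gt0//.
  rewrite mulrC ler_pdivrMr ?exprn_gt0//.
  apply: (le_trans (ler_normD _ _)).
  have -> : K * h ^+ 2 * h ^+ 2 = K * h ^+ 4 by ring.
  have : 2 * L * h ^+ 4 <= K * h ^+ 4.
    by rewrite ler_pM2r ?exprn_gt0// /K; lra.
  lra.
- move=> t h h0 lo hi; have [tT tpT tmT hT] := inT _ _ h0 lo hi.
  have := tayA _ _ tpT tT; have := tayA _ _ tmT tT.
  rewrite [t + h - t]addrAC subrr add0r [t - h - t]addrAC subrr add0r.
  rewrite normrN (gtr0_norm h0).
  set rm := (X in `|X| <= _); set rp := (X in _ -> `|X| <= _ -> _) => hm hp.
  have -> : 2^-1 *: (A (u (t + h)) + A (u (t - h))) - A (u t) = 2^-1 *: (rp + rm).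
    apply: (ip_inj hip) => z; rewrite /rp /rm.
    by rewrite !(ipDl, ipBl, ipNl, ipZl); field.
  rewrite normrZ gtr0_norm ?invr_gt0//.
  have := ler_normD rp rm.
  have : LA * h ^+ 2 <= K * h ^+ 2.
    by rewrite ler_pM2r ?exprn_gt0// /K; lra.
  lra.
- move=> h h0 hT; have hT' : h \in `[0, T] by rewrite in_itv/= ltW.
  have := tay _ _ hT' zT; rewrite subr0 (gtr0_norm h0).
  set r := (X in `|X| <= _) => hr.
  have -> : u h - (u 0 + h *: u1 0 + (h ^+ 2 / 2) *: u2 0) =
      r + (h ^+ 3 / 6) *: u3 0.
    by apply: (ip_inj hip) => z; rewrite /r !(ipDl, ipBl, ipNl, ipZl); field.
  apply: (le_trans (ler_normD _ _)).
  have h30 : 0 < h ^+ 3 by rewrite exprn_gt0.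
  rewrite normrZ gtr0_norm ?divr_gt0//.
  have e1 : L * h ^+ 4 <= L * T * h ^+ 3.
    by rewrite exprS mulrA ler_pM2r// ler_pM2l.
  have e2 : h ^+ 3 / 6 * `|u3 0| <= M3 * h ^+ 3.
    have := ler_wpM2r (ltW h30) (h3 _ zT).
    have : 0 <= `|u3 0| * h ^+ 3 by rewrite mulr_ge0// ltW.
    lra.
  have : L * T * h ^+ 3 + M3 * h ^+ 3 <= K * h ^+ 3.
    by rewrite -mulrDl ler_pM2r// /K; lra.
  lra.
- move=> h h0 hT; have hT' : h \in `[0, T] by rewrite in_itv/= ltW.
  have d0 := domB (domu _ hT') (domu _ zT); have d1 := domZ h (domu1 _ zT).
  apply: (le_trans (sqrt_le _ (domB d0 d1))).
  rewrite (appB d0 d1) (appB (domu _ hT') (domu _ zT)) (appZ _ (domu1 _ zT)).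
  have := tayA _ _ hT' zT; rewrite subr0 (gtr0_norm h0) => hr.
  apply: (@le_trans _ _ (k * (LA * h ^+ 2))).
    by rewrite ler_wpM2l//; lra.
  by rewrite mulrA ler_wpM2r ?sqr_ge0// /K; lra.
Qed.

End Consistency.

(** * Discrete energy estimates *)

Section DiscreteEnergy.
Context (R : realType).

Section Wave.
Context (H : completeNormedModType R).
Context (ip : {dot H for @idfun R}) (hip : forall x : H, ip x x = `|x| ^+ 2).

(** Pairing with x2 - x0 telescopes both terms: it is h times the sum of the two
    velocities, and the mixed terms of the elastic part cancel by symmetry.
    The vectors y0 and y2 stand for the images of x0 and x2 under a symmetric
    operator. *)
Lemma wave_energy_step (h q : R) (x0 x1 x2 y0 y2 g : H) :
  0 < h -> ip y2 x0 = ip y0 x2 ->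
  (h ^+ 2)^-1 *: (x2 - 2 *: x1 + x0) + q *: (2^-1 *: (y2 + y0)) = g ->
  let d1 := `|h^-1 *: (x2 - x1)| ^+ 2 in
  let d0 := `|h^-1 *: (x1 - x0)| ^+ 2 in
  d1 + q / 2 * ip y2 x2 <=
    d0 + q / 2 * ip y0 x0 + h * (`|g| ^+ 2 + (d1 + d0) / 2).
Proof.
move=> h0 sym eg /=.
set p1 := h^-1 *: (x2 - x1); set p0 := h^-1 *: (x1 - x0).
have E : `|p1| ^+ 2 + q / 2 * ip y2 x2 - (`|p0| ^+ 2 + q / 2 * ip y0 x0) =
    h * (ip g p1 + ip g p0).
  rewrite -!hip -eg /p1 /p0 !(ipDl, ipDr, ipBl, ipBr, ipNl, ipNr, ipZl, ipZr).
  rewrite sym (ipC ip x1 x0) (ipC ip x2 x0) (ipC ip x2 x1).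
  by field; rewrite gt_eqF.
have young p : ip g p <= `|g| ^+ 2 / 2 + `|p| ^+ 2 / 2.
  apply: (le_trans (ip_le hip _ _)).
  by have := sqr_ge0 (`|g| - `|p|); rewrite sqrrB; lra.
have : h * (ip g p1 + ip g p0) <=
    h * (`|g| ^+ 2 + (`|p1| ^+ 2 + `|p0| ^+ 2) / 2).
  by rewrite ler_pM2l//; have := young p1; have := young p0; lra.
lra.
Qed.

End Wave.

(** Adds the two energy balances.  Capital letters X, Y, G, F stand for squared
    norms.  The coefficient is frozen at q1 in the first balance, so passing
    from E0 to E1 costs (q1 - q0) (X1 + X0) / 2; this is of order h E0, and so
    is the forcing up to h^5. *)
Lemma energy_growth (al ga h q1 q0 C1 C2 d1 d0 e1 e0 X2 X1 X0 Y1 l2 l1 l0 G F : R) :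
  0 < al -> 0 < ga -> 0 < h -> 0 <= C1 -> 0 <= C2 ->
  al <= q1 -> al <= q0 -> q1 - q0 <= C1 * h ->
  0 <= d1 -> 0 <= d0 -> 0 <= e1 -> 0 <= e0 ->
  0 <= X2 -> 0 <= X1 -> 0 <= X0 -> 0 <= l2 -> ga * Y1 <= l1 -> 0 <= Y1 -> 0 <= l0 ->
  d1 + q1 / 2 * X2 <= d0 + q1 / 2 * X0 + h * (G + (d1 + d0) / 2) ->
  e1 + 1 / 2 * l2 <= e0 + 1 / 2 * l0 + h * (F + (e1 + e0) / 2) ->
  G + F <= C2 * (h ^+ 4 + X1 + Y1) ->
  let E1 := d1 + q1 / 2 * (X2 + X1) + e1 + (l2 + l1) / 2 in
  let E0 := d0 + q0 / 2 * (X1 + X0) + e0 + (l1 + l0) / 2 in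
  E1 <= E0 + (C1 / al + C2 * (1 + 2 / al + 2 / ga) + 1) * h * (h ^+ 4 + E0 + E1).
Proof.
move=> al0 ga0 h0 C10 C20 q1al q0al dq d10 d00 e10 e00 X20 X10 X00 l20 hl1 Y10 l00.
move=> HU HV HGF /=.
set E1 := (X in X <= _); set E0 := (X in _ <= X + _).
have gaY : 0 <= ga * Y1 by rewrite mulr_ge0// ltW.
have X00' : 0 <= q0 / 2 * (X1 + X0).
  by rewrite mulr_ge0 ?addr_ge0// divr_ge0//; lra.
have X22' : 0 <= q1 / 2 * (X2 + X1).
  by rewrite mulr_ge0 ?addr_ge0// divr_ge0//; lra.
have E00 : 0 <= E0 by rewrite /E0; lra.
have E10 : 0 <= E1 by rewrite /E1; lra.
have X1X0 : X1 + X0 <= 2 / al * E0.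
  rewrite mulrAC ler_pdivlMr// [_ * al]mulrC.
  have : al * (X1 + X0) <= q0 * (X1 + X0) by rewrite ler_wpM2r// addr_ge0.
  by rewrite /E0; lra.
have Y1E : Y1 <= 2 / ga * E0.
  by rewrite mulrAC ler_pdivlMr// [_ * ga]mulrC /E0; lra.
have step : E1 - E0 <= (q1 - q0) / 2 * (X1 + X0)
    + h * (G + F + (d1 + d0 + e1 + e0) / 2).
  by rewrite /E1 /E0; lra.
have t1 : (q1 - q0) / 2 * (X1 + X0) <= C1 / al * h * E0.
  have : (q1 - q0) * (X1 + X0) <= C1 * h * (X1 + X0).
    by rewrite ler_wpM2r// addr_ge0.
  have : C1 * h * (X1 + X0) <= C1 * h * (2 / al * E0).
    by rewrite ler_wpM2l// mulr_ge0// ltW.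
  have -> : C1 * h * (2 / al * E0) = 2 * (C1 / al * h * E0) by ring.
  lra.
have a0 : 0 <= 2 / al by rewrite divr_ge0// ltW.
have g0 : 0 <= 2 / ga by rewrite divr_ge0// ltW.
have h40 : 0 <= h ^+ 4 by rewrite exprn_ge0// ltW.
have t2 : G + F <= C2 * (1 + 2 / al + 2 / ga) * (h ^+ 4 + E0 + E1).
  apply: (le_trans HGF); rewrite -mulrA ler_wpM2l//.
  have : 0 <= 2 / al * (h ^+ 4 + E1) by rewrite mulr_ge0// addr_ge0.
  have : 0 <= 2 / ga * (h ^+ 4 + E1) by rewrite mulr_ge0// addr_ge0.
  lra.
have t3 : h * (G + F + (d1 + d0 + e1 + e0) / 2) <=
    h * ((C2 * (1 + 2 / al + 2 / ga) + 1) * (h ^+ 4 + E0 + E1)).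
  by rewrite ler_pM2l// [leRHS]mulrDl mul1r lerD// /E0 /E1; lra.
have t4 : C1 / al * h * E0 <= C1 / al * h * (h ^+ 4 + E0 + E1).
  have c0 : 0 <= C1 / al * h by rewrite mulr_ge0 ?divr_ge0//; exact: ltW.
  by rewrite ler_wpM2l//; lra.
have -> : (C1 / al + C2 * (1 + 2 / al + 2 / ga) + 1) * h * (h ^+ 4 + E0 + E1) =
    C1 / al * h * (h ^+ 4 + E0 + E1)
    + h * ((C2 * (1 + 2 / al + 2 / ga) + 1) * (h ^+ 4 + E0 + E1)) by ring.
rewrite -lerBlDl; apply: (le_trans step).
apply: lerD; [exact: le_trans t1 t4 | exact: t3].
Qed.

(** As long as the energy stays below M h^4, one step adds at most a multiple
    of h^5, and over a short interval these increments add up to at most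
    h^4; so the bound M h^4 propagates without a discrete Gronwall factor. *)
Lemma energy_bootstrap (E : nat -> R) (N : nat) (h C C0 : R) :
  let M := C0 + 1 in
  0 < h -> 0 < C -> 0 <= C0 -> C * h <= 2^-1 ->
  2 * C * (2 * M + 1) * (N%:R * h) <= 1 ->
  E 0%N <= C0 * h ^+ 4 ->
  (forall k, (0 < k <= N)%N -> (forall j, (j < k)%N -> E j <= M * h ^+ 4) ->
     E k <= E k.-1 + C * h * (h ^+ 4 + E k.-1 + E k)) ->
  forall k, (k <= N)%N -> E k <= M * h ^+ 4.
Proof.
move=> M h0 C_0 C00 Ch hN hE0 step.
have h40 : 0 < h ^+ 4 by rewrite exprn_gt0.
pose D := 2 * C * (2 * M + 1) * h.
have D0 : 0 <= D by rewrite !mulr_ge0 ?ltW// /M; lra.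
have below k : (k <= N)%N -> E k <= (C0 + D * k%:R) * h ^+ 4 -> E k <= M * h ^+ 4.
  move=> kN; move/le_trans; apply; rewrite ler_pM2r// lerD2l.
  apply: (le_trans _ hN); rewrite [N%:R * h]mulrC mulrA -/D.
  by rewrite ler_wpM2l// ler_nat.
suff main k : (k <= N)%N -> forall j, (j <= k)%N ->
    E j <= (C0 + D * j%:R) * h ^+ 4.
  by move=> k kN; apply: below => //; exact: main kN _ (leqnn k).
elim: k => [|k IH] kN j.
  by rewrite leqn0 => /eqP->; rewrite mulr0 addr0.
rewrite leq_eqVlt => /orP[/eqP->|]; last first.
  by rewrite ltnS => jk; apply: IH => //; exact: ltnW.
have IHM i : (i < k.+1)%N -> E i <= M * h ^+ 4.
  rewrite ltnS => ik; apply: below; last by apply: IH => //; exact: ltnW.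
  exact: leq_trans ik (ltnW kN).
have /= st := step k.+1 kN IHM.
have Ek := IH (ltnW kN) k (leqnn k); have EkM := IHM k (leqnn _).
have Ch0 : 0 < C * h by rewrite mulr_gt0.
(* h^4 + 2 E_k <= (2 M + 1) h^4 and 1 - C h >= 1/2 *)
have incr : E k.+1 - E k <= 2 * (C * h) * ((2 * M + 1) * h ^+ 4).
  have b : C * h * (h ^+ 4 + 2 * E k) <= C * h * ((2 * M + 1) * h ^+ 4).
    by rewrite ler_pM2l//; lra.
  have [le0|gt0] := lerP (E k.+1 - E k) 0.
    apply: (le_trans le0); rewrite !mulr_ge0 ?ltW// /M; lra.
  have : C * h * (E k.+1 - E k) <= 2^-1 * (E k.+1 - E k) by rewrite ler_pM2r.
  lra.
rewrite -natr1 mulrDr mulr1 addrA mulrDl.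
have -> : D * h ^+ 4 = 2 * (C * h) * ((2 * M + 1) * h ^+ 4) by rewrite /D; ring.
lra.
Qed.

End DiscreteEnergy.

(** * Convergence of the scheme *)

Section Convergence.
Context (R : realType) (H : completeNormedModType R).
Context (ip : {dot H for @idfun R}) (hip : forall x : H, ip x x = `|x| ^+ 2).
Context (P : system H) (T : R) (D : data H).
Local Notation A := (opA P).
Local Notation S := (opA12 P).
Local Notation B := (opB P).
Local Notation C := (opC P).
Local Notation L := (opL P).
Context (halpha : 0 < alpha P) (hbeta : 0 < beta P).
Context (hgamma : 0 < gamma P) (hdelta : 0 < delta P).
Context (hA : self_adjoint ip A) (hS : is_sqrt_op ip A S).
Context (nu : R) (hnu : 0 < nu).
Context (hAnu : forall x, dom A x -> nu * `|x| ^+ 2 <= ip (A x) x).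
Context (hCsym : forall x y, ip (C x) y = ip x (C y)).
Context (MC : R) (hMC : 0 <= MC) (hCbnd : forall x, `|C x| <= MC * `|x|).
Context (hCpos : forall x, 0 <= ip (C x) x).
Context (hBdom : dom A `<=` dom B).
Context (cB : R) (hcB : 0 < cB).
Context (hBA : forall x, dom A x -> `|B x| ^+ 2 <= cB ^+ 2 * ip (A x) x).
Context (T0 : 0 < T).

Let domS x (dx : dom A x) : dom S x := sqrt_dom hS dx.
Let energy x (dx : dom A x) : ip (A x) x = `|S x| ^+ 2 := sqrt_energy hip hS dx.
Let k := kappa nu.
Let k1 : 1 <= k := kappa_ge1 hnu.

Let k0 : 0 <= k := le_trans ler01 k1.

Lemma opL_sub x y : dom A x -> dom A y -> L (x - y) = L x - L y.
Proof.
move=> dx dy; rewrite /opL appB// (linearB (opC P)) !scalerBr.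
by rewrite opprD addrACA.
Qed.

Lemma opL_sym x y : dom A x -> dom A y -> ip (L x) y = ip x (L y).
Proof.
move=> dx dy; rewrite /opL !(ipDl, ipDr, ipZl, ipZr).
by rewrite (self_adjoint_sym hA)// hCsym.
Qed.

Lemma opL_lower x : dom A x -> gamma P * `|S x| ^+ 2 <= ip (L x) x.
Proof.
move=> dx; rewrite /opL !(ipDl, ipZl) energy// lerDl.
by rewrite mulr_ge0// ltW.
Qed.

(** Bounds L by A both as a form and in norm, because C is bounded and |x| is
    at most k^2 |A x|. *)
Definition opL_bound := gamma P + delta P * (MC * k ^+ 2).

Lemma opL_bound_ge0 : 0 <= opL_bound.
Proof.
by apply: addr_ge0; [exact: ltW|rewrite mulr_ge0 ?(ltW hdelta)// mulr_ge0 ?sqr_ge0].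
Qed.

Lemma opL_upper x : dom A x -> ip (L x) x <= opL_bound * `|S x| ^+ 2.
Proof.
move=> dx; rewrite /opL !(ipDl, ipZl) energy// /opL_bound mulrDl lerD2l.
rewrite -mulrA ler_pM2l// -mulrA -exprMn.
apply: (le_trans (ip_le hip _ _)).
apply: (le_trans (ler_wpM2r (normr_ge0 _) (hCbnd x))).
rewrite -mulrA -expr2 ler_wpM2l// lerXn2r ?nnegrE ?mulr_ge0//.
exact: (norm_le_sqrt hip hS hnu hAnu).
Qed.

Lemma opL_norm x : dom A x -> `|L x| <= opL_bound * `|A x|.
Proof.
move=> dx; apply: (le_trans (ler_normD _ _)).
rewrite !normrZ !gtr0_norm// /opL_bound mulrDl lerD2l -mulrA ler_pM2l//.
apply: (le_trans (hCbnd x)); rewrite -mulrA ler_wpM2l//.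
apply: (le_trans (norm_le_sqrt hip hS hnu hAnu dx)).
rewrite -/k expr2 -mulrA ler_wpM2l//.
exact: (sqrt_le_app hip hS hnu hAnu).
Qed.

Lemma opB_norm x : dom A x -> `|B x| <= cB * `|S x|.
Proof.
move=> dx; have cB0 := ltW hcB.
by rewrite -ler_sqr ?nnegrE ?mulr_ge0// exprMn -energy// hBA.
Qed.

Lemma kirchhoff_diff x y K1 K2 : dom S x -> dom S y ->
  `|S x| <= K1 -> `|S y| <= K2 ->
  `|kirchhoff P x - kirchhoff P y| <= beta P * (K1 + K2) * `|S (x - y)|.
Proof.
move=> dx dy hx hy; rewrite /kirchhoff.
have -> : alpha P + beta P * `|S x| ^+ 2 - (alpha P + beta P * `|S y| ^+ 2) =
    beta P * ((`|S x| + `|S y|) * (`|S x| - `|S y|)) by ring.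
rewrite normrM gtr0_norm// -mulrA ler_pM2l// normrM ler_pM//.
  by rewrite ger0_norm ?addr_ge0// lerD.
by rewrite appB// ler_dist_dist.
Qed.

Lemma kirchhoff_ge x : alpha P <= kirchhoff P x.
Proof. by rewrite lerDl mulr_ge0 ?sqr_ge0// ltW. Qed.

Section Residuals.
Context (u u1 u2 v v1 v2 : R -> H) (Ku Kv : R).
Context (Ku0 : 0 < Ku) (Kv0 : 0 < Kv).
Context (hu : consistent A S T u u1 u2 Ku) (hv : consistent A S T v v1 v2 Kv).
Context (domu : forall t : R, t \in `[0, T] -> dom A (u t)).
Context (domv : forall t : R, t \in `[0, T] -> dom A (v t)).
Context (equ : forall t : R, t \in `[0, T] ->
  u2 t + kirchhoff P (u t) *: A (u t) + a1 P *: B (v t) = f1 D t).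
Context (eqv : forall t : R, t \in `[0, T] ->
  v2 t + L (v t) + a2 P *: B (u t) = f2 D t).

(** The four terms bound the truncation error of the second difference, that
    of the mean of A u, the difference of the Kirchhoff coefficients and the
    coupling. *)
Definition residual_u := Ku + (alpha P + beta P * Ku ^+ 2) * Ku
  + beta P * (2 * Ku + 1) * Ku + `|a1 P| * cB.

Definition residual_v := Kv + opL_bound * Kv + `|a2 P| * cB.

Lemma residual_u_ge0 : 0 <= residual_u.
Proof.
have Ku' := ltW Ku0; have be := ltW hbeta; have al := ltW halpha.
have r2 : 0 <= alpha P + beta P * Ku ^+ 2.
  by apply: addr_ge0 => //; rewrite mulr_ge0 ?sqr_ge0// ltW.
have r3 : 0 <= beta P * (2 * Ku + 1) by rewrite mulr_ge0 ?(ltW hbeta)//; lra.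
apply: addr_ge0; last by rewrite mulr_ge0 ?(ltW hcB).
by rewrite !addr_ge0// mulr_ge0.
Qed.

Lemma residual_v_ge0 : 0 <= residual_v.
Proof.
have Kv' := ltW Kv0; have cB' := ltW hcB.
by rewrite !addr_ge0// mulr_ge0// opL_bound_ge0.
Qed.

Lemma kirchhoff_solution_le (t : R) : t \in `[0, T] ->
  `|kirchhoff P (u t)| <= alpha P + beta P * Ku ^+ 2.
Proof.
move=> tT; rewrite ger0_norm; last exact: le_trans (ltW halpha) (kirchhoff_ge _).
rewrite lerD2l ler_pM2l// lerXn2r ?nnegrE ?(ltW Ku0)//.
exact: (consistent_sqrt hu tT).
Qed.

(** The coefficient is quadratic in S x; an error of at most 1 in S x keeps the
    second argument bounded, so that the error of the coefficient is linear. *)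
Lemma kirchhoff_error (t : R) x : t \in `[0, T] -> dom A x ->
  `|S (u t - x)| <= 1 ->
  `|kirchhoff P (u t) - kirchhoff P x|
    <= beta P * (2 * Ku + 1) * `|S (u t - x)|.
Proof.
move=> tT dx z1; have dut := domu tT.
have -> : 2 * Ku + 1 = Ku + (Ku + 1) by ring.
apply: kirchhoff_diff; [exact: domS|exact: domS|exact: (consistent_sqrt hu tT)|].
have -> : S x = S (u t) - S (u t - x).
  by rewrite appB; [rewrite opprB addrC subrK|exact: domS..].
by apply: (le_trans (ler_normB _ _)); rewrite lerD//; exact: (consistent_sqrt hu tT).
Qed.

Lemma in_segment (t h : R) : 0 < h -> 0 <= t - h -> t + h <= T ->
  [/\ t \in `[0, T], t + h \in `[0, T] & t - h \in `[0, T]].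
Proof.
by move=> h0 lo hi; split; rewrite in_itv/=; apply/andP; split; lra.
Qed.

(** The exact equation at t carries the coefficient of u t and the value A (u t),
    the scheme that of U0 and a mean of A; trading one for the other produces
    the truncation errors and the difference of the coefficients. *)
Lemma residual_u_le (t h : R) Um U0 Up V0 :
  0 < h -> 0 <= t - h -> t + h <= T ->
  dom A Um -> dom A U0 -> dom A Up -> dom A V0 ->
  `|S (u t - U0)| <= 1 ->
  (h ^+ 2)^-1 *: (Up - 2 *: U0 + Um)
    + kirchhoff P U0 *: (2^-1 *: (A Up + A Um)) = f1 D t - a1 P *: B V0 ->
  let zp := u (t + h) - Up in let zm := u (t - h) - Um in
  `|(h ^+ 2)^-1 *: (zp - 2 *: (u t - U0) + zm)
      + kirchhoff P U0 *: (2^-1 *: (A zp + A zm))|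
    <= residual_u * (h ^+ 2 + `|S (u t - U0)| + `|S (v t - V0)|).
Proof.
move=> h0 lo hi dUm dU0 dUp dV0 z1 scheme /=.
have [tT tpT tmT] := in_segment h0 lo hi.
have dw := domB (domv tT) dV0; have dut := domu tT.
pose c2 := (h ^+ 2)^-1 *: (u (t + h) - 2 *: u t + u (t - h)) - u2 t.
pose cm := 2^-1 *: (A (u (t + h)) + A (u (t - h))) - A (u t).
pose ku := kirchhoff P (u t); pose kU := kirchhoff P U0.
pose Am := 2^-1 *: (A (u (t + h)) + A (u (t - h))).
have -> : (h ^+ 2)^-1 *: (u (t + h) - Up - 2 *: (u t - U0) + (u (t - h) - Um))
      + kU *: (2^-1 *: (A (u (t + h) - Up) + A (u (t - h) - Um))) =
    c2 + ku *: cm - (ku - kU) *: Am - a1 P *: B (v t - V0).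
  rewrite (appB (domu tpT) dUp) (appB (domu tmT) dUm).
  rewrite (appB (hBdom (domv tT)) (hBdom dV0)).
  apply: (ip_inj hip) => y.
  have := congr1 (ip^~ y) scheme; have := congr1 (ip^~ y) (equ tT).
  rewrite /c2 /cm /Am -/ku -/kU !(ipDl, ipBl, ipNl, ipZl) => <- sc.
  apply/eqP; rewrite -subr_eq0; apply/eqP.
  move/eqP: sc; rewrite -subr_eq0 => /eqP sc.
  by rewrite -[RHS]oppr0 -sc; field; rewrite gt_eqF.
have nAm : `|Am| <= Ku.
  rewrite /Am normrZ gtr0_norm ?invr_gt0//.
  have := ler_normD (A (u (t + h))) (A (u (t - h))).
  have := consistent_app hu tpT; have := consistent_app hu tmT; lra.
have nc2 : `|c2| <= Ku * h ^+ 2 := consistent_second hu h0 lo hi.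
have ncm : `|ku *: cm| <= (alpha P + beta P * Ku ^+ 2) * (Ku * h ^+ 2).
  rewrite normrZ ler_pM//; first exact: kirchhoff_solution_le.
  exact: (consistent_mean hu _ _ _).
have dk : `|ku - kU| <= beta P * (2 * Ku + 1) * `|S (u t - U0)|.
  exact: kirchhoff_error.
have nk : `|(ku - kU) *: Am| <= beta P * (2 * Ku + 1) * Ku * `|S (u t - U0)|.
  by rewrite normrZ -mulrA [Ku * _]mulrC mulrA ler_pM.
have nB : `|a1 P *: B (v t - V0)| <= `|a1 P| * cB * `|S (v t - V0)|.
  by rewrite normrZ -mulrA ler_wpM2l// opB_norm.
apply: (le_trans (ler_normB _ _)); apply: (le_trans (lerD (ler_normB _ _) nB)).
apply: (le_trans (lerD (lerD (ler_normD _ _) nk) (lexx _))).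
have := normr_ge0 (S (u t - U0)); have := normr_ge0 (S (v t - V0)).
set x := `|S (u t - U0)|; set y := `|S (v t - V0)| => y0 x0.
have h20 : 0 <= h ^+ 2 by exact: sqr_ge0.
rewrite /residual_u; move: nc2 ncm; rewrite [_ * (Ku * _)]mulrA.
set r2 := _ * Ku; set r3 := beta P * _ * Ku; set r4 := `|a1 P| * cB.
have r20 : 0 <= r2.
  apply: mulr_ge0; last exact: ltW.
  by apply: addr_ge0; [exact: ltW|rewrite mulr_ge0 ?sqr_ge0// ltW].
have r30 : 0 <= r3.
  rewrite mulr_ge0 ?(ltW Ku0)// mulr_ge0 ?(ltW hbeta)//.
  by have := ltW Ku0; lra.
have r40 : 0 <= r4 by rewrite mulr_ge0// ltW.
move=> n2 nm.
have := mulr_ge0 (ltW Ku0) x0; have := mulr_ge0 (ltW Ku0) y0.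
have := mulr_ge0 r20 x0; have := mulr_ge0 r20 y0.
have := mulr_ge0 r30 h20; have := mulr_ge0 r30 y0.
have := mulr_ge0 r40 h20; have := mulr_ge0 r40 x0.
lra.
Qed.

(** Same as for u, with a linear operator; the factor 1 is the coefficient q in
    the energy balance. *)
Lemma residual_v_le (t h : R) Vm V0 Vp U0 :
  0 < h -> 0 <= t - h -> t + h <= T ->
  dom A Vm -> dom A V0 -> dom A Vp -> dom A U0 ->
  (h ^+ 2)^-1 *: (Vp - 2 *: V0 + Vm) + 2^-1 *: (L Vp + L Vm)
    = f2 D t - a2 P *: B U0 ->
  let wp := v (t + h) - Vp in let wm := v (t - h) - Vm in
  `|(h ^+ 2)^-1 *: (wp - 2 *: (v t - V0) + wm) + 1 *: (2^-1 *: (L wp + L wm))|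
    <= residual_v * (h ^+ 2 + `|S (u t - U0)|).
Proof.
move=> h0 lo hi dVm dV0 dVp dU0 scheme /=.
have [tT tpT tmT] := in_segment h0 lo hi.
have dz := domB (domu tT) dU0; have dvt := domv tT.
pose c2 := (h ^+ 2)^-1 *: (v (t + h) - 2 *: v t + v (t - h)) - v2 t.
pose cm := 2^-1 *: (v (t + h) + v (t - h)) - v t.
have dhalf : dom A (2^-1 *: (v (t + h) + v (t - h))).
  by apply: domZ; apply: domD; exact: domv.
have dcm : dom A cm by apply: domB => //; exact: domv.
have Acm : A cm = 2^-1 *: (A (v (t + h)) + A (v (t - h))) - A (v t).
  rewrite appB//; congr (_ - _); rewrite appZ; last by apply: domD; exact: domv.
  by rewrite appD//; exact: domv.
have -> : (h ^+ 2)^-1 *: (v (t + h) - Vp - 2 *: (v t - V0) + (v (t - h) - Vm))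
      + 1 *: (2^-1 *: (L (v (t + h) - Vp) + L (v (t - h) - Vm))) =
    c2 + L cm - a2 P *: B (u t - U0).
  rewrite (opL_sub (domv tpT) dVp) (opL_sub (domv tmT) dVm).
  rewrite (appB (hBdom (domu tT)) (hBdom dU0)).
  have -> : L cm = 2^-1 *: (L (v (t + h)) + L (v (t - h))) - L (v t).
    rewrite /opL Acm /cm (linearB (opC P)) (linearZ_LR (opC P)) (linearD (opC P)).
    by apply: (ip_inj hip) => y; rewrite !(ipDl, ipBl, ipNl, ipZl); field.
  apply: (ip_inj hip) => y.
  have := congr1 (ip^~ y) scheme; have := congr1 (ip^~ y) (eqv tT).
  rewrite /c2 !(ipDl, ipBl, ipNl, ipZl) => <- sc.
  apply/eqP; rewrite -subr_eq0; apply/eqP.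
  move/eqP: sc; rewrite -subr_eq0 => /eqP sc.
  by rewrite -[RHS]oppr0 -sc; field; rewrite gt_eqF.
have nc2 : `|c2| <= Kv * h ^+ 2 := consistent_second hv h0 lo hi.
have ncm : `|L cm| <= opL_bound * Kv * h ^+ 2.
  apply: (le_trans (opL_norm dcm)).
  rewrite -mulrA ler_wpM2l ?opL_bound_ge0// Acm.
  exact: (consistent_mean hv _ _ _).
have nB : `|a2 P *: B (u t - U0)| <= `|a2 P| * cB * `|S (u t - U0)|.
  by rewrite normrZ -mulrA ler_wpM2l// opB_norm.
apply: (le_trans (ler_normB _ _)).
apply: (le_trans (lerD (ler_normD _ _) nB)).
rewrite /residual_v; have x0 := normr_ge0 (S (u t - U0)).
have h20 : 0 <= h ^+ 2 by exact: sqr_ge0.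
have := mulr_ge0 (ltW Kv0) x0.
have := mulr_ge0 (mulr_ge0 opL_bound_ge0 (ltW Kv0)) x0.
have := mulr_ge0 (mulr_ge0 (normr_ge0 (a2 P)) (ltW hcB)) h20.
lra.
Qed.

(** Bounds (q_k - q_(k-1)) / h, through the two coefficient errors, each at most
    beta (2 Ku + 1) h, and the variation of the exact coefficient. *)
Definition kirchhoff_rate := beta P * (2 * (2 * Ku + 1) + 2 * Ku * Ku).

Lemma kirchhoff_rate_ge0 : 0 <= kirchhoff_rate.
Proof.
rewrite mulr_ge0 ?(ltW hbeta)// addr_ge0//; last by rewrite !mulr_ge0 ?(ltW Ku0).
by have := ltW Ku0; lra.
Qed.

(** The factor 3 comes from squaring a sum of three terms. *)
Definition forcing_const := 3 * residual_u ^+ 2 + 3 * residual_v ^+ 2.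

Lemma forcing_const_ge0 : 0 <= forcing_const.
Proof. by rewrite addr_ge0 ?mulr_ge0 ?residual_u_ge0 ?residual_v_ge0. Qed.

Definition growth_const := kirchhoff_rate / alpha P
  + forcing_const * (1 + 2 / alpha P + 2 / gamma P) + 1.

(** Bounds the initial energy over h^4.  The starting vectors agree with the
    solution up to O(h^3) in norm, but only up to O(h^2) under S, since the
    second derivatives at time 0 lie merely in the domain of S. *)
Definition start_const := Ku ^+ 2
  + kirchhoff P (phi0 D) / 2 * (Ku + `|S (phi2 P D)|) ^+ 2
  + Kv ^+ 2 + opL_bound / 2 * (Kv + `|S (psi2 P D)|) ^+ 2.

Lemma growth_const_gt0 : 0 < growth_const.
Proof.
have rate0 := kirchhoff_rate_ge0; have forc0 := forcing_const_ge0.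
have a0 : 0 <= 2 / alpha P by rewrite divr_ge0// ltW.
have g0 : 0 <= 2 / gamma P by rewrite divr_ge0// ltW.
rewrite ltr_wpDl// addr_ge0 ?divr_ge0 ?(ltW halpha)//.
by rewrite mulr_ge0// !addr_ge0.
Qed.

Section Scheme.
Context (u0 : u 0 = phi0 D) (u10 : u1 0 = phi1 D).
Context (v0 : v 0 = psi0 D) (v10 : v1 0 = psi1 D).
Context (dphi1 : dom A (phi1 D)) (dpsi1 : dom A (psi1 D)).
Context (dphi2 : dom S (phi2 P D)) (dpsi2 : dom S (psi2 P D)).
Context (n : nat) (n3 : (2 < n)%N) (U V : nat -> H).
Context (scheme : is_scheme P T D n U V).
Let h := T / n%:R.
Let t (i : nat) : R := i%:R * h.
Let z i := u (t i) - U i.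
Let w i := v (t i) - V i.

Let n0 : 0 < n%:R :> R.
Proof. by rewrite ltr0n; case: (n) n3. Qed.

Let h0 : 0 < h.
Proof. exact: divr_gt0. Qed.

Let nh : n%:R * h = T.
Proof. by rewrite /h mulrCA mulfV ?mulr1// gt_eqF. Qed.

Let tS i : t i.+1 = t i + h.
Proof. by rewrite /t -natr1 mulrDl mul1r. Qed.

Let t_in i : (i <= n)%N -> t i \in `[0, T].
Proof.
move=> hin; rewrite in_itv/= /t mulr_ge0 ?(ltW h0)//=.
by rewrite -nh ler_pM2r// ler_nat.
Qed.

(* Step i + 1 evaluates A at u_i and step i - 1 evaluates it at u_i; the first is
   available for i = 0 and i = 1 because n is at least 3, the second for the
   other indices. *)
Let dom_scheme i : (i <= n)%N -> dom A (U i) /\ dom A (V i).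
Proof.
case: scheme => _ _ _ _ sch hin.
have [i2|i2] := ltnP i 2.
  have [|[]//] := sch i.+1.
  by rewrite /=; apply: leq_trans i2 _; rewrite ltn_predRL.
have [|[_ dU _ dV] _ _ _] := sch i.-1.
  by rewrite ltn_predRL i2 -!subn1 leq_sub2r.
by move: dU dV; rewrite prednK//; case: (i) i2.
Qed.

Let domU i : (i <= n)%N -> dom A (U i).
Proof. by case/dom_scheme. Qed.

Let domV i : (i <= n)%N -> dom A (V i).
Proof. by case/dom_scheme. Qed.

Let domz i : (i <= n)%N -> dom A (z i).
Proof. by move=> hin; apply: domB; [exact/domu/t_in|exact: domU]. Qed.

Let domw i : (i <= n)%N -> dom A (w i).
Proof. by move=> hin; apply: domB; [exact/domv/t_in|exact: domV]. Qed.

(* kinetic and elastic energies of both errors, at the half step i + 1/2 *)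
Let E i := `|h^-1 *: (z i.+1 - z i)| ^+ 2
  + kirchhoff P (U i) / 2 * (`|S (z i.+1)| ^+ 2 + `|S (z i)| ^+ 2)
  + `|h^-1 *: (w i.+1 - w i)| ^+ 2
  + (ip (L (w i.+1)) (w i.+1) + ip (L (w i)) (w i)) / 2.

Let z0 : z 0 = 0.
Proof. by case: scheme => e _ _ _ _; rewrite /z /t mul0r e u0 subrr. Qed.

Let w0 : w 0 = 0.
Proof. by case: scheme => _ _ e _ _; rewrite /w /t mul0r e v0 subrr. Qed.

Let hT : h <= T.
Proof.
by rewrite -nh ler_peMl ?(ltW h0)// ler1n; case: (n) n3.
Qed.

Lemma start_error (a a1 a2 : R -> H) (K : R) (x : H) :
  0 < K -> consistent A S T a a1 a2 K ->
  (forall t : R, t \in `[0, T] -> dom A (a t)) ->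
  dom A (a1 0) -> dom S (a2 0) ->
  x = a h - (a 0 + h *: a1 0 + (h ^+ 2 / 2) *: a2 0) ->
  `|h^-1 *: x| ^+ 2 <= K ^+ 2 * h ^+ 4 /\
  `|S x| ^+ 2 <= (K + `|S (a2 0)|) ^+ 2 * h ^+ 4.
Proof.
move=> K0 ha da da1 da2 ex; have h20 : 0 <= h ^+ 2 by exact: sqr_ge0.
have e4 : h ^+ 4 = (h ^+ 2) ^+ 2 by rewrite -exprM.
have KS0 : 0 <= K + `|S (a2 0)| by rewrite addr_ge0// ltW.
split; rewrite e4 -exprMn lerXn2r ?nnegrE ?(mulr_ge0 (ltW K0)) ?(mulr_ge0 KS0)//.
  rewrite normrZ gtr0_norm ?invr_gt0// mulrC ler_pdivrMr// -mulrA -exprSr ex.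
  exact: (consistent_start ha h0 hT).
have zT : 0 \in `[0, T] by rewrite in_itv/= lexx ltW.
have hhT : h \in `[0, T] by rewrite in_itv/= (ltW h0).
have d1 : dom S (a h - a 0 - h *: a1 0).
  by apply/domS/domB; [apply: domB; exact: da|exact: domZ].
have -> : S x = S (a h - a 0 - h *: a1 0) - (h ^+ 2 / 2) *: S (a2 0).
  rewrite -(appZ _ da2) -(appB d1); last exact: domZ.
  by rewrite ex !opprD !addrA.
apply: (le_trans (ler_normB _ _)); rewrite mulrDl lerD//.
  exact: (consistent_sqrt_start ha h0 hT).
rewrite normrZ ger0_norm ?divr_ge0// [leRHS]mulrC ler_wpM2r//; lra.
Qed.

Lemma start_energy : E 0 <= start_const * h ^+ 4.
Proof.
have zT : 0 \in `[0, T] by rewrite in_itv/= lexx ltW.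
have u20 : u2 0 = phi2 P D.
  have := equ zT; rewrite u0 v0 /phi2 => <-.
  by rewrite !addrK.
have v20 : v2 0 = psi2 P D.
  by have := eqv zT; rewrite u0 v0 /psi2 => <-; rewrite addrK addrK.
have t1 : t 1 = h by rewrite /t mul1r.
have du20 : dom S (u2 0) by rewrite u20.
have dv20 : dom S (v2 0) by rewrite v20.
have du10 : dom A (u1 0) by rewrite u10.
have dv10 : dom A (v1 0) by rewrite v10.
have [eU eV] : z 1 = u h - (u 0 + h *: u1 0 + (h ^+ 2 / 2) *: u2 0) /\
    w 1 = v h - (v 0 + h *: v1 0 + (h ^+ 2 / 2) *: v2 0).
  by case: scheme => _ eU _ eV _; rewrite /z /w t1 eU eV u0 u10 u20 v0 v10 v20.
have [zd zS] := start_error Ku0 hu domu du10 du20 eU.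
have [wd wS] := start_error Kv0 hv domv dv10 dv20 eV.
have wL := opL_upper (domw (leq_trans (isT : (1 <= 2)%N) (ltnW n3))).
have U0 : U 0%N = phi0 D by case: scheme.
rewrite /E z0 w0 !subr0 U0 ip0r app0 normr0 expr0n /= !addr0 /start_const.
rewrite -u20 -v20.
have k0' : 0 <= kirchhoff P (phi0 D) / 2.
  by rewrite divr_ge0// (le_trans (ltW halpha))// kirchhoff_ge.
have := ler_wpM2l k0' zS; have := ler_wpM2l opL_bound_ge0 wS.
lra.
Qed.

(** The hypothesis that both errors are at most h under S makes the increment of
    the Kirchhoff coefficient O(h), with a rate independent of the errors. *)
Lemma step_energy j : (j.+1 < n)%N -> h <= 1 ->
  `|S (z j)| <= h -> `|S (z j.+1)| <= h ->
  E j.+1 <= E j + growth_const * h * (h ^+ 4 + E j + E j.+1).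
Proof.
move=> jn h1 zj zj1; have jn' := ltnW jn; have jn'' := ltnW jn'.
have [_ _ _ _ sch] := scheme.
have [|_ _ schU schV] := sch j.+1.
  by move: jn; case: (n) => [|m]//; rewrite ltnS.
have lo : 0 <= t j.+1 - h.
  by rewrite tS addrK; have := t_in jn''; rewrite in_itv/= => /andP[].
have hi : t j.+1 + h <= T.
  by rewrite -tS; have := t_in jn; rewrite in_itv/= => /andP[].
have z1 : `|S (u (t j.+1) - U j.+1)| <= 1 by exact: le_trans h1.
have resU := residual_u_le h0 lo hi (domU jn'') (domU jn') (domU jn) (domV jn') z1 schU.
have resV := residual_v_le h0 lo hi (domV jn'') (domV jn') (domV jn) (domU jn') schV.
have tP : t j.+1 - h = t j by rewrite tS addrK.
move: resU resV; rewrite /= -!(tS j.+1) !tP -/(z j) -/(z j.+1) -/(z j.+2).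
rewrite -/(w j) -/(w j.+1) -/(w j.+2).
set gu := (X in `|X| <= _); set gv := (X in _ -> `|X| <= _ -> _) => hgu hgv.
have dz0 := domz jn''; have dz1 := domz jn'; have dz2 := domz jn.
have dw0 := domw jn''; have dw1 := domw jn'; have dw2 := domw jn.
have symA : ip (A (z j.+2)) (z j) = ip (A (z j)) (z j.+2).
  by rewrite (self_adjoint_sym hA)// ipC.
have symL : ip (L (w j.+2)) (w j) = ip (L (w j)) (w j.+2).
  by rewrite opL_sym// ipC.
have := wave_energy_step hip h0 symA (erefl gu).
have := wave_energy_step hip h0 symL (erefl gv).
rewrite /= !energy// => eV eU.
have lower i : dom A i -> 0 <= ip (L i) i.
  move=> di; apply: le_trans (opL_lower di).
  by rewrite mulr_ge0 ?sqr_ge0// ltW.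
have Kudiff i : (i <= n)%N -> `|S (z i)| <= h ->
    `|kirchhoff P (u (t i)) - kirchhoff P (U i)| <= beta P * (2 * Ku + 1) * h.
  move=> hin zi.
  apply: (le_trans (kirchhoff_error (t_in hin) (domU hin) (le_trans zi h1))).
  by rewrite ler_wpM2l// mulr_ge0 ?(ltW hbeta)//; have := ltW Ku0; lra.
have dq : kirchhoff P (U j.+1) - kirchhoff P (U j) <= kirchhoff_rate * h.
  have a := Kudiff _ jn' zj1; have b := Kudiff _ jn'' zj.
  have c : `|kirchhoff P (u (t j.+1)) - kirchhoff P (u (t j))| <=
      beta P * (2 * Ku * Ku) * h.
    have -> : beta P * (2 * Ku * Ku) * h = beta P * (Ku + Ku) * (Ku * h) by ring.
    apply: (le_trans (kirchhoff_diff (K1 := Ku) (K2 := Ku) _ _ _ _)).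
    - exact/domS/domu/t_in.
    - exact/domS/domu/t_in.
    - exact: (consistent_sqrt hu (t_in jn')).
    - exact: (consistent_sqrt hu (t_in jn'')).
    - rewrite ler_wpM2l ?mulr_ge0 ?(ltW hbeta)//; first by have := ltW Ku0; lra.
      have := consistent_sqrt_lip hu (t_in jn') (t_in jn'').
      by rewrite [in `|_ - _|]tS [t j + h - _]addrAC subrr add0r (gtr0_norm h0).
  move: a b c; rewrite !ler_norml /kirchhoff_rate.
  by case/andP=> ? ? /andP[? ?] /andP[? ?]; lra.
have sq3 (a x y c : R) : 0 <= a -> 0 <= c <= a * (h ^+ 2 + x + y) -> 0 <= x -> 0 <= y ->
    c ^+ 2 <= 3 * a ^+ 2 * (h ^+ 4 + x ^+ 2 + y ^+ 2).
  move=> a0 /andP[c0 hc] x0 y0.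
  have s0 : 0 <= h ^+ 2 + x + y by rewrite !addr_ge0// sqr_ge0.
  apply: (@le_trans _ _ ((a * (h ^+ 2 + x + y)) ^+ 2)).
    by rewrite lerXn2r ?nnegrE ?mulr_ge0.
  have -> : 3 * a ^+ 2 * (h ^+ 4 + x ^+ 2 + y ^+ 2) =
      a ^+ 2 * (3 * (h ^+ 4 + x ^+ 2 + y ^+ 2)) by ring.
  rewrite exprMn ler_wpM2l ?sqr_ge0//.
  have -> : h ^+ 4 = (h ^+ 2) ^+ 2 by rewrite -exprM.
  have := sqr_ge0 (h ^+ 2 - x); have := sqr_ge0 (h ^+ 2 - y).
  by have := sqr_ge0 (x - y); rewrite !sqrrB; lra.
have ru0 := residual_u_ge0; have rv0 := residual_v_ge0.
have gu2 : `|gu| ^+ 2 <=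
    3 * residual_u ^+ 2 * (h ^+ 4 + `|S (z j.+1)| ^+ 2 + `|S (w j.+1)| ^+ 2).
  by apply: sq3 => //; rewrite normr_ge0.
have gv2 : `|gv| ^+ 2 <= 3 * residual_v ^+ 2 * (h ^+ 4 + `|S (z j.+1)| ^+ 2).
  have := sq3 residual_v `|S (z j.+1)| 0 `|gv| rv0.
  by rewrite expr0n/= !addr0 normr_ge0; apply.
have rate0 := kirchhoff_rate_ge0; have forc0 := forcing_const_ge0.
have forc : `|gu| ^+ 2 + `|gv| ^+ 2 <=
    forcing_const * (h ^+ 4 + `|S (z j.+1)| ^+ 2 + `|S (w j.+1)| ^+ 2).
  have : 0 <= 3 * residual_v ^+ 2 * `|S (w j.+1)| ^+ 2.
    by rewrite !mulr_ge0 ?sqr_ge0.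
  rewrite /forcing_const; lra.
exact: (energy_growth halpha hgamma h0 rate0 forc0 (kirchhoff_ge _) (kirchhoff_ge _)
  dq (sqr_ge0 _) (sqr_ge0 _) (sqr_ge0 _) (sqr_ge0 _) (sqr_ge0 _) (sqr_ge0 _)
  (sqr_ge0 _) (lower _ dw2) (opL_lower dw1) (sqr_ge0 _) (lower _ dw0) eU eV forc).
Qed.

Lemma start_const_ge0 : 0 <= start_const.
Proof.
have k0' : 0 <= kirchhoff P (phi0 D) / 2.
  by rewrite divr_ge0// (le_trans (ltW halpha))// kirchhoff_ge.
have l0 : 0 <= opL_bound / 2 by rewrite divr_ge0// opL_bound_ge0.
by rewrite /start_const !addr_ge0 ?sqr_ge0// mulr_ge0 ?sqr_ge0.
Qed.

Let M := start_const + 1.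

Let energy_components i : (i < n)%N ->
  [/\ alpha P / 2 * (`|S (z i.+1)| ^+ 2 + `|S (z i)| ^+ 2) <= E i,
      `|h^-1 *: (z i.+1 - z i)| ^+ 2 <= E i &
      `|h^-1 *: (w i.+1 - w i)| ^+ 2 <= E i].
Proof.
move=> hin; have dw0 := opL_lower (domw (ltnW hin)).
have dw1 := opL_lower (domw hin).
have gS x : 0 <= gamma P * `|S x| ^+ 2 by rewrite mulr_ge0 ?sqr_ge0// ltW.
have a2 : 0 < alpha P / 2 by rewrite divr_gt0.
have X0 : 0 <= `|S (z i.+1)| ^+ 2 + `|S (z i)| ^+ 2 by rewrite addr_ge0 ?sqr_ge0.
have X : alpha P / 2 * (`|S (z i.+1)| ^+ 2 + `|S (z i)| ^+ 2) <=
    kirchhoff P (U i) / 2 * (`|S (z i.+1)| ^+ 2 + `|S (z i)| ^+ 2).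
  by rewrite ler_wpM2r// ler_pM2r// kirchhoff_ge.
have aX := mulr_ge0 (ltW a2) X0.
have := gS (w i); have := gS (w i.+1).
have := sqr_ge0 `|h^-1 *: (z i.+1 - z i)|.
have := sqr_ge0 `|h^-1 *: (w i.+1 - w i)|.
by rewrite /E; split; lra.
Qed.

(** The bound M h^4 at step j forces the errors under S below h there, which is
    what the next energy step requires; M h <= alpha / 2 and h <= 1 give
    M h^4 <= alpha h^2 / 2. *)
Lemma energy_bound (N : nat) : (N < n)%N -> h <= 1 ->
  growth_const * h <= 2^-1 -> 2 * growth_const * (2 * M + 1) * (N%:R * h) <= 1 ->
  2 * M * h <= alpha P ->
  forall i, (i <= N)%N -> E i <= M * h ^+ 4.
Proof.
move=> Nn h1 gh gN Mh; have g0 := growth_const_gt0; have s0 := start_const_ge0.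
apply: (energy_bootstrap (C0 := start_const) h0 g0 s0 gh gN start_energy).
move=> [|j]//= jN below; have Ej := below j (ltnSn j).
have jn := leq_ltn_trans jN Nn.
have [X1 X0] : `|S (z j.+1)| <= h /\ `|S (z j)| <= h.
  have a2 : 0 < alpha P / 2 by rewrite divr_gt0.
  have [Xj _ _] := energy_components (ltnW jn).
  have Xs : alpha P / 2 * (`|S (z j.+1)| ^+ 2 + `|S (z j)| ^+ 2) <= alpha P / 2 * h ^+ 2.
    apply: (le_trans Xj).
    apply: (le_trans Ej); have h20 : 0 < h ^+ 2 by rewrite exprn_gt0.
    have -> : M * h ^+ 4 = (M * h) * h * h ^+ 2 by ring.
    rewrite ler_pM2r//.
    have : M * h * h <= M * h * 1.
      by rewrite ler_wpM2l// mulr_ge0 ?(ltW h0)// /M; lra.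
    by lra.
  move: Xs; rewrite ler_pM2l// => Xs.
  split; rewrite -ler_sqr ?nnegrE ?(ltW h0)//.
    by have := sqr_ge0 `|S (z j)|; lra.
  by have := sqr_ge0 `|S (z j.+1)|; lra.
exact: step_energy.
Qed.

(** The error of the central difference quotient splits into its truncation
    error for the exact solution and the mean of two velocities of the error. *)
Lemma derivative_error (N i : nat) : (N < n)%N -> h <= 1 ->
  growth_const * h <= 2^-1 -> 2 * growth_const * (2 * M + 1) * (N%:R * h) <= 1 ->
  2 * M * h <= alpha P -> (0 < i <= N)%N ->
  `|u1 (t i) - (2 * h)^-1 *: (U i.+1 - U i.-1)| <= (Ku + (M + 1)) * h ^+ 2 /\
  `|v1 (t i) - (2 * h)^-1 *: (V i.+1 - V i.-1)| <= (Kv + (M + 1)) * h ^+ 2.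
Proof.
move=> Nn h1 gh gN Mh /andP[]; case: i => // j _ jN /=.
have bound := energy_bound Nn h1 gh gN Mh.
have M0 : 0 <= M by have := start_const_ge0; rewrite /M; lra.
have jn := leq_ltn_trans jN Nn.
have speed i : (i <= N)%N -> `|h^-1 *: (z i.+1 - z i)| <= (M + 1) * h ^+ 2 /\
    `|h^-1 *: (w i.+1 - w i)| <= (M + 1) * h ^+ 2.
  move=> iN; have Ei := bound i iN.
  have [_ zE wE] := energy_components (leq_ltn_trans iN Nn).
  have h40 : 0 <= h ^+ 4 by rewrite exprn_ge0// ltW.
  have Mh4 : M * h ^+ 4 <= ((M + 1) * h ^+ 2) ^+ 2.
    have -> : ((M + 1) * h ^+ 2) ^+ 2 = (M + 1) ^+ 2 * h ^+ 4 by ring.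
    by rewrite ler_wpM2r// sqrrD; have := sqr_ge0 M; lra.
  have Mh2 : 0 <= (M + 1) * h ^+ 2.
    by apply: mulr_ge0; [lra | exact: sqr_ge0].
  by split; rewrite -ler_sqr ?nnegrE//; lra.
have [zj wj] := speed j (ltnW jN); have [zj1 wj1] := speed j.+1 jN.
have tP : t j.+1 - h = t j by rewrite tS addrK.
have lo : 0 <= t j.+1 - h.
  by rewrite tP; have := t_in (ltnW (ltnW jn)); rewrite in_itv/= => /andP[].
have hi : t j.+1 + h <= T.
  by rewrite -tS; have := t_in jn; rewrite in_itv/= => /andP[].
have split_error (a a1 : R -> H) (X : nat -> H) (e1 e0 : H) (K : R) :
    `|a1 (t j.+1) - (2 * h)^-1 *: (a (t j.+1 + h) - a (t j.+1 - h))| <= K * h ^+ 2 ->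
    e1 = h^-1 *: (a (t j.+2) - X j.+2 - (a (t j.+1) - X j.+1)) ->
    e0 = h^-1 *: (a (t j.+1) - X j.+1 - (a (t j) - X j)) ->
    `|e1| <= (M + 1) * h ^+ 2 -> `|e0| <= (M + 1) * h ^+ 2 ->
    `|a1 (t j.+1) - (2 * h)^-1 *: (X j.+2 - X j)| <= (K + (M + 1)) * h ^+ 2.
  rewrite -tS tP => hc ee1 ee0 n1 n0'.
  have -> : a1 (t j.+1) - (2 * h)^-1 *: (X j.+2 - X j) =
      a1 (t j.+1) - (2 * h)^-1 *: (a (t j.+2) - a (t j)) + 2^-1 *: (e1 + e0).
    rewrite ee1 ee0; apply: (ip_inj hip) => y.
    by rewrite !(ipDl, ipBl, ipNl, ipZl); field; rewrite gt_eqF.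
  apply: (le_trans (ler_normD _ _)); rewrite [leRHS]mulrDl lerD//.
  rewrite normrZ gtr0_norm ?invr_gt0//; have := ler_normD e1 e0; lra.
split.
- exact: (split_error u u1 U _ _ _ (consistent_centered hu h0 lo hi) erefl erefl).
- exact: (split_error v v1 V _ _ _ (consistent_centered hv h0 lo hi) erefl erefl).
Qed.

End Scheme.
End Residuals.
End Convergence.

Theorem corollary6p3 (R : realType) (H : completeNormedModType R)
  (ip : {dot H for @idfun R}) (hip : forall x : H, ip x x = `|x| ^+ 2)
  (P : system H)
  (halpha : 0 < alpha P) (hbeta : 0 < beta P)
  (hgamma : 0 < gamma P) (hdelta : 0 < delta P)
  (hA : self_adjoint ip (opA P))
  (nu : R) (hnu : 0 < nu)
  (hAnu : forall x, dom (opA P) x -> nu * `|x| ^+ 2 <= ip (opA P x) x)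
  (hA12 : is_sqrt_op ip (opA P) (opA12 P))
  (hCsym : forall x y, ip (opC P x) y = ip x (opC P y))
  (hCbnd : exists M : R, forall x, `|opC P x| <= M * `|x|)
  (hCpos : forall x, 0 <= ip (opC P x) x)
  (hBclosed : closed_op (opB P))
  (hBdom : dom (opA P) `<=` dom (opB P))
  (cB : R) (hcB : 0 < cB)
  (hBA : forall x, dom (opA P) x ->
     `|opB P x| ^+ 2 <= cB ^+ 2 * ip (opA P x) x)
  (T : R) (hT : 0 < T)
  (D : data H)
  (hwp : well_posed P T D)
  (u v : R -> H) (huv : is_solution P T D u v)
  (* (a) *)
  (ha_phi0 : dom (opA P) (phi0 D)) (ha_psi0 : dom (opA P) (psi0 D))
  (ha_phi1 : dom (opA12 P) (phi1 D)) (ha_psi1 : dom (opA12 P) (psi1 D))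
  (ha_phi2 : dom (opA12 P) (phi2 P D)) (ha_psi2 : dom (opA12 P) (psi2 P D))
  (ha_f1 : {within `[0, T], continuous (f1 D)})
  (ha_f2 : {within `[0, T], continuous (f2 D)})
  (ha_f1dom : forall t, t \in `[0, T] -> dom (opA12 P) (f1 D t))
  (ha_f2dom : forall t, t \in `[0, T] -> dom (opA12 P) (f2 D t))
  (ha_A12f1 : {within `[0, T], continuous (fun t => opA12 P (f1 D t))})
  (ha_A12f2 : {within `[0, T], continuous (fun t => opA12 P (f2 D t))})
  (* (b) *)
  (hb_u : contdiff T 3 u) (hb_v : contdiff T 3 v)
  (hb_u3 : [lipschitz iter 3 (derive_on T) u t | t in `[0, T]])
  (hb_v3 : [lipschitz iter 3 (derive_on T) v t | t in `[0, T]])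
  (* (c) *)
  (hc_Au : contdiff T 1 (fun t => opA P (u t)))
  (hc_Av : contdiff T 1 (fun t => opA P (v t)))
  (hc_du : forall t, t \in `[0, T] -> dom (opA P) (derive_on T u t))
  (hc_dv : forall t, t \in `[0, T] -> dom (opA P) (derive_on T v t))
  (hc_Adu : [lipschitz opA P (derive_on T u t) | t in `[0, T]])
  (hc_Adv : [lipschitz opA P (derive_on T v t) | t in `[0, T]]) :
  exists Tbar : R, 0 < Tbar <= T /\
  exists c c' : R, [/\ 0 < c, 0 < c' &
    forall (n : nat) (U V : nat -> H), (1 < n)%N -> is_scheme P T D n U V ->
    let tau := T / n%:R in
    let m := Num.truncn (Tbar / tau) in
    \big[Num.max/0]_(1 <= k < (minn m n.-1).+1)
      `|derive_on T u (k%:R * tau) - (2 * tau)^-1 *: (U k.+1 - U k.-1)|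
        <= c * tau ^+ 2 /\
    \big[Num.max/0]_(1 <= k < (minn m n.-1).+1)
      `|derive_on T v (k%:R * tau) - (2 * tau)^-1 *: (V k.+1 - V k.-1)|
        <= c' * tau ^+ 2].
Proof.
have [MC hMC] := hCbnd.
have hMC' x : `|opC P x| <= `|MC| * `|x|.
  by apply: (le_trans (hMC x)); rewrite ler_wpM2r// ler_norm.
have zT : 0 \in `[0, T] by rewrite in_itv/= lexx ltW.
case: hb_u => _ [du [_ [du1 [_ [du2 _]]]]].
case: hb_v => _ [dv [_ [dv1 [_ [dv2 _]]]]].
case: (huv) => _ dom_uv _ eqs [u0 u10 v0 v10].
have domu t : t \in `[0, T] -> dom (opA P) (u t) by case/dom_uv.
have domv t : t \in `[0, T] -> dom (opA P) (v t) by case/dom_uv.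
have [Lu Lu0 hLu] := lipschitz_onP hb_u3.
have [Lv Lv0 hLv] := lipschitz_onP hb_v3.
have [LAu LAu0 hLAu] := lipschitz_onP hc_Adu.
have [LAv LAv0 hLAv] := lipschitz_onP hc_Adv.
have [Ku Ku0 hu] := smooth_consistent hip hA hA12 hnu hAnu hT Lu0 LAu0
  (derivable_onP hT du) (derivable_onP hT du1) (derivable_onP hT du2)
  domu hc_du hLu hLAu.
have [Kv Kv0 hv] := smooth_consistent hip hA hA12 hnu hAnu hT Lv0 LAv0
  (derivable_onP hT dv) (derivable_onP hT dv1) (derivable_onP hT dv2)
  domv hc_dv hLv hLAv.
have equ (t : R) : t \in `[0, T] -> derive_on T (derive_on T u) t
    + kirchhoff P (u t) *: opA P (u t) + a1 P *: opB P (v t) = f1 D t.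
  by case/eqs.
have eqv (t : R) : t \in `[0, T] -> derive_on T (derive_on T v) t
    + opL P (v t) + a2 P *: opB P (u t) = f2 D t.
  by case/eqs => _; rewrite /opL addrA.
have dphi1 : dom (opA P) (phi1 D) by rewrite -u10; exact: hc_du.
have dpsi1 : dom (opA P) (psi1 D) by rewrite -v10; exact: hc_dv.
have err n U V (n3 : (2 < n)%N) (sch : is_scheme P T D n U V) N i :=
  @derivative_error R H ip hip P T D halpha hbeta hgamma hdelta hA hA12 nu hnu
    hAnu hCsym `|MC| (normr_ge0 MC) hMC' hCpos hBdom cB hcB hBA hT
    u _ _ v _ _ Ku Kv Ku0 Kv0 hu hv domu domv equ eqv u0 u10 v0 v10
    dphi1 dpsi1 ha_phi2 ha_psi2 n n3 U V sch N i.
move: err; set G := growth_const _ _ _ _ _ _; set M := start_const _ _ _ _ _ _ + 1 => err.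
have G0 : 0 < G by exact: (growth_const_gt0 halpha hbeta hgamma hdelta).
have M0 : 0 <= M by rewrite addr_ge0// (start_const_ge0 D halpha hbeta hgamma hdelta).
(* 1 / s is the final time: each smallness condition on h or on the final time
   asks that it be at most the inverse of one of the terms of s, and the term
   3 / T makes n at least 3 *)
pose s : R := 1 + 3 / T + 2 * G + 2 * G * (2 * M + 1) + 2 * M / alpha P.
have c1 : 0 <= 3 / T by rewrite divr_ge0// ltW.
have c2 : 0 <= 2 * G by rewrite mulr_ge0// ltW.
have c3 : 0 <= 2 * G * (2 * M + 1) by rewrite mulr_ge0//; lra.
have c4 : 0 <= 2 * M / alpha P by rewrite divr_ge0 ?(ltW halpha)//; lra.
have s0 : 0 < s by rewrite /s; lra.
have small (x c : R) : x <= s^-1 -> 0 <= c <= s -> c * x <= 1.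
  move=> xs /andP[c0 cs]; apply: (@le_trans _ _ (c * s^-1)).
    by rewrite ler_wpM2l.
  by rewrite ler_pdivrMr// mul1r.
have sT : 3 * s^-1 <= T.
  have : 3 / T * s^-1 <= 1 by apply: small; rewrite // c1 /s; lra.
  by rewrite mulrAC ler_pdivrMr// mul1r.
have si0 : 0 < s^-1 by rewrite invr_gt0.
exists s^-1; split; first by rewrite si0; lra.
exists (Ku + (M + 1)), (Kv + (M + 1)); split; [lra|lra|].
move=> n U V n1 sch /=; set h := T / n%:R; set m := Num.trunc _.
have n0 : 0 < n%:R :> R by rewrite ltr0n ltnW.
have h0 : 0 < h by exact: divr_gt0.
have key k : (0 < k < (minn m n.-1).+1)%N ->
    `|derive_on T u (k%:R * h) - (2 * h)^-1 *: (U k.+1 - U k.-1)|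
      <= (Ku + (M + 1)) * h ^+ 2 /\
    `|derive_on T v (k%:R * h) - (2 * h)^-1 *: (V k.+1 - V k.-1)|
      <= (Kv + (M + 1)) * h ^+ 2.
  move=> /andP[k0 kN]; rewrite ltnS in kN.
  have mh : m%:R * h <= s^-1.
    by rewrite -ler_pdivlMr// truncn_le divr_ge0// ltW.
  have Nh : (minn m n.-1)%:R * h <= s^-1.
    by apply: le_trans mh; rewrite ler_pM2r// ler_nat geq_minl.
  have hs : h <= s^-1.
    by apply: le_trans Nh; rewrite ler_peMl ?(ltW h0)// ler1n (leq_trans k0).
  have n3 : (2 < n)%N.
    rewrite -(ler_nat R); move: hs; rewrite /h ler_pdivrMr// => hs.
    by rewrite -(ler_pM2r si0); lra.
  have Nn : (minn m n.-1 < n)%N.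
    by rewrite (leq_ltn_trans (geq_minr _ _))// ltn_predL ltnW.
  apply: (err n U V n3 sch _ _ Nn).
  - have := small h 1 hs; rewrite mul1r; apply; rewrite ler01 /s; lra.
  - have : 2 * G * h <= 1 by apply: small => //; rewrite c2 /s; lra.
    by rewrite -/h; lra.
  - by apply: small => //; rewrite c3 /s; lra.
  - have : 2 * M / alpha P * h <= 1 by apply: small => //; rewrite c4 /s; lra.
    by rewrite mulrAC ler_pdivrMr// mul1r.
  - by rewrite k0.
have h20 : 0 <= h ^+ 2 by exact: sqr_ge0.
split; rewrite big_nat; apply: bigmax_le => [|k /key[]//].
- by rewrite mulr_ge0//; lra.
- by rewrite mulr_ge0//; lra.
Qed.
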